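(* There is a polynomial-time algorithm that, given a CNF $\psi$ and a tree decomposition of width $k$ of the primal graph $G_\psi$, produces a DNF $\psi'$ and a tree decomposition of width $k+4$ of $G_{\psi'}$ such that for every assignment $\alpha\sqsubseteq\mathrm{vars}(\psi)$: $\psi|\alpha=\emptyset$ if and only if $\psi'|\alpha$ is a tautology (i.e., $\neg(\psi'|\alpha)$ is unsatisfiable).
   Context: A CNF is viewed as a set of clauses and a DNF as a set of terms, where clauses and terms are sets of literals. $\alpha\sqsubseteq V$ means that $\alpha$ is an assignment of variables of $V$, given as a set of literals over $V$ not containing both polarities of any variable. For a CNF $\psi$, $\psi|\alpha$ is obtained by deleting all clauses containing a literal of $\alpha$ and removing from the remaining clauses all literals whose negation is in $\alpha$; $\alpha$ satisfies $\psi$ if $\psi|\alpha=\emptyset$. For a DNF $\psi'$, $\psi'|\alpha$ is obtained by deleting all terms containing a literal whose negation is in $\alpha$ and removing the literals of $\alpha$ from the remaining terms. The DNF $\psi'$ may contain variables not occurring in $\psi$. The primal graph of a CNF or DNF has the variables as vertices and an edge between two variables occurring together in a clause or term. Width of a tree decomposition is maximum bag size minus one.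
   Formalization: The clauses of the CNF ψ are assumed not to contain both polarities of a variable; without this the claim fails, e.g. for ψ = {{x, ¬x}}, where ψ|α = ∅ for α = {x} and α = {¬x} but not for the empty α. *)

(* Defs.v *)
From mathcomp Require Import all_boot all_order all_algebra.

Set Implicit Arguments.
Unset Strict Implicit.
Unset Printing Implicit Defensive.

(* Finite sets of literals, clauses and terms are represented by lists: every
   notion below depends only on membership, never on order or repetition. *)

(* (x, true) is the literal x and (x, false) is its negation. *)
Definition literal : Type := nat * bool.
Definition neg_lit (l : literal) : literal := (l.1, ~~ l.2).

Definition CNF : Type := seq (seq literal).
Definition DNF : Type := seq (seq literal).

Definition vars (F : seq (seq literal)) : seq nat :=
  undup [seq l.1 | l <- flatten F].

Definition consistent (s : seq literal) : bool :=
  all (fun l => neg_lit l \notin s) s.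

(* Clauses and terms are subject to the usual convention that they do not
   contain a variable in both polarities. *)
Definition well_formed (F : seq (seq literal)) : bool := all consistent F.

Definition assignment (V : seq nat) (a : seq literal) : bool :=
  consistent a && all (fun l => l.1 \in V) a.

Definition restrict_cnf (psi : CNF) (a : seq literal) : CNF :=
  [seq [seq l <- C | neg_lit l \notin a]
     | C <- psi & ~~ has (fun l => l \in a) C].

Definition restrict_dnf (psi : DNF) (a : seq literal) : DNF :=
  [seq [seq l <- t | l \notin a]
     | t <- psi & ~~ has (fun l => neg_lit l \in a) t].

Definition satisfies (a : seq literal) (psi : CNF) : Prop :=
  restrict_cnf psi a = [::].

Definition satisfiable (psi : CNF) : Prop :=
  exists2 a, assignment (vars psi) a & satisfies a psi.

(* By De Morgan, the negation of a DNF is a CNF. *)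
Definition negation (psi : DNF) : CNF := [seq map neg_lit t | t <- psi].

Definition tautology (psi : DNF) : Prop := ~ satisfiable (negation psi).

Definition primal_edge (F : seq (seq literal)) (x y : nat) : bool :=
  (x != y) &&
  has (fun C => (x \in [seq l.1 | l <- C]) && (y \in [seq l.1 | l <- C])) F.

(* The nodes of the tree are the positions 0, ..., n-1 in the list of bags. *)
Record tree_dec : Type := TreeDec {
  bags : seq (seq nat);
  links : seq (nat * nat)
}.

Definition nb_nodes (T : tree_dec) : nat := size (bags T).

Definition bag (T : tree_dec) (i : nat) : seq nat := nth [::] (bags T) i.

Definition adjacent (T : tree_dec) : rel 'I_(nb_nodes T) :=
  fun i j => ((val i, val j) \in links T) || ((val j, val i) \in links T).

(* Nonempty, loop-free, connected, and without simple cycles of length at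
   least 3 (a ucycle of size 2 is an edge followed back and forth). *)
Definition is_tree (T : tree_dec) : Prop :=
  [/\ 0 < nb_nodes T,
      all (fun e => [&& e.1 < nb_nodes T, e.2 < nb_nodes T & e.1 != e.2])
          (links T),
      forall i j, connect (@adjacent T) i j
    & forall c, ucycle (@adjacent T) c -> size c <= 2].

Definition adjacent_at (T : tree_dec) (x : nat) : rel 'I_(nb_nodes T) :=
  fun i j => [&& adjacent i j, x \in bag T i & x \in bag T j].

Definition is_tree_decomposition (V : seq nat) (E : rel nat) (T : tree_dec)
    : Prop :=
  [/\ is_tree T,
      forall B x, B \in bags T -> x \in B -> x \in V,
      forall x, x \in V -> exists2 B, B \in bags T & x \in B,
      forall x y, x \in V -> y \in V -> E x y ->
        exists2 B, B \in bags T & (x \in B) && (y \in B)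
    & forall x (i j : 'I_(nb_nodes T)), x \in bag T i -> x \in bag T j ->
        connect (@adjacent_at T x) i j].

Definition primal_tree_dec (F : seq (seq literal)) (T : tree_dec) : Prop :=
  is_tree_decomposition (vars F) (primal_edge F) T.

(* An integer, since the width is -1 when all bags are empty. *)
Definition width (T : tree_dec) : int :=
  ((\max_(B <- bags T) size (undup B))%:Z - 1)%R.

(* The machine model is Jones's WHILE language over binary trees.  A step is
   charged for the size of every tree it builds or reads (and not a unit per
   operation, which would allow trees of exponential size, shared as DAGs, to
   be built in linear time), so that running times are polynomially related to
   those of Turing machines. *)

Inductive data : Type := Leaf | Node of data & data.

Fixpoint data_size (d : data) : nat :=
  if d is Node d1 d2 then (data_size d1 + data_size d2).+1 else 1.

Fixpoint data_eq (d e : data) : bool :=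
  match d, e with
  | Leaf, Leaf => true
  | Node d1 d2, Node e1 e2 => data_eq d1 e1 && data_eq d2 e2
  | _, _ => false
  end.

Inductive expr : Type :=
  | Var of nat
  | Nil
  | Cons of expr & expr
  | Head of expr
  | Tail of expr
  | Equal of expr & expr.

Inductive cmd : Type :=
  | Skip
  | Assign of nat & expr
  | Seq of cmd & cmd
  | If of expr & cmd & cmd
  | While of expr & cmd.

Definition store : Type := nat -> data.

Definition update (s : store) (x : nat) (d : data) : store :=
  fun y => if y == x then d else s y.

Definition enc_bool (b : bool) : data := if b then Node Leaf Leaf else Leaf.

(* Conditions hold when they evaluate to something else than Leaf. *)
Definition truth (d : data) : bool := if d is Leaf then false else true.

Fixpoint eval (s : store) (e : expr) : data :=
  match e with
  | Var x => s x
  | Nil => Leaf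
  | Cons e1 e2 => Node (eval s e1) (eval s e2)
  | Head e1 => if eval s e1 is Node d _ then d else Leaf
  | Tail e1 => if eval s e1 is Node _ d then d else Leaf
  | Equal e1 e2 => enc_bool (data_eq (eval s e1) (eval s e2))
  end.

Fixpoint cost (s : store) (e : expr) : nat :=
  data_size (eval s e) +
  match e with
  | Var _ | Nil => 0
  | Head e1 | Tail e1 => cost s e1
  | Cons e1 e2 | Equal e1 e2 => cost s e1 + cost s e2
  end.

(* exec s c s' t: from the store s, the command c halts in the store s' after
   time t. *)
Inductive exec : store -> cmd -> store -> nat -> Prop :=
  | ExecSkip s : exec s Skip s 1
  | ExecAssign s x e :
      exec s (Assign x e) (update s x (eval s e)) (cost s e).+1
  | ExecSeq s c1 s1 t1 c2 s2 t2 :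
      exec s c1 s1 t1 -> exec s1 c2 s2 t2 ->
      exec s (Seq c1 c2) s2 (t1 + t2).+1
  | ExecIf s e c1 c2 s' t :
      exec s (if truth (eval s e) then c1 else c2) s' t ->
      exec s (If e c1 c2) s' (cost s e + t).+1
  | ExecWhileStop s e c :
      ~~ truth (eval s e) -> exec s (While e c) s (cost s e).+1
  | ExecWhileLoop s e c s1 t1 s2 t2 :
      truth (eval s e) -> exec s c s1 t1 -> exec s1 (While e c) s2 t2 ->
      exec s (While e c) s2 (cost s e + t1 + t2).+1.

(* The input is read from, and the output left in, variable 0; the other
   variables initially hold Leaf. *)
Definition runs (P : cmd) (input output : data) (t : nat) : Prop :=
  exists2 s : store,
    exec (update (fun _ => Leaf) 0 input) P s t & s 0 = output.

Definition enc_seq (A : Type) (enc : A -> data) (s : seq A) : data :=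
  foldr (fun a d => Node (enc a) d) Leaf s.

Definition enc_pair (A B : Type) (encA : A -> data) (encB : B -> data)
    (p : A * B) : data :=
  Node (encA p.1) (encB p.2).

(* Binary notation, least significant digit first, without trailing zeros. *)
Definition bits (n : nat) : seq bool :=
  [seq odd (n %/ 2 ^ i) | i <- iota 0 (up_log 2 n.+1)].

Definition enc_nat (n : nat) : data := enc_seq enc_bool (bits n).

Definition enc_formula (F : seq (seq literal)) : data :=
  enc_seq (enc_seq (enc_pair enc_nat enc_bool)) F.

Definition enc_tree_dec (T : tree_dec) : data :=
  Node (enc_seq (enc_seq enc_nat) (bags T))
       (enc_seq (enc_pair enc_nat enc_nat) (links T)).

Definition enc_instance (F : seq (seq literal)) (T : tree_dec) : data :=
  Node (enc_formula F) (enc_tree_dec T).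

(* Main.v *)
Require Import Defs.
From mathcomp Require Import all_boot all_order all_algebra.
From mathcomp Require Import zify.

Set Implicit Arguments.
Unset Strict Implicit.
Unset Printing Implicit Defensive.

(* The tree of T is rooted by a search from node 0, and a token walks down it.
   Every node v has a current variable q, which says that the token is at v.  A
   choice at v consumes q and introduces q' and r, with the constraint
   q -> q' \/ r: q' becomes the current variable of v, and r either passes the
   token to a child of v or says that the token takes a clause contained in the
   bag of v, whose literals must then all be false.  The first current variable
   must be true and the last ones false, so these constraints, whose negation is
   psi', are satisfiable together with an assignment exactly when it leaves some
   clause of psi without a true literal.  Each choice yields a copy of the bag
   of v, with q, q', r and a dummy variable d added, attached to the previous
   copy: the width is k + 4 exactly.  By the Helly property of subtrees, every
   clause lies in some bag.

   Polynomial time is obtained from a class of typed functions closed under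
   pairing, composition, conditionals and those left folds whose accumulator
   stays polynomially bounded. *)

(** * Polynomial time *)

(** That some clause is falsified is a disjunction over all clauses. A single constraint joining one
    selector per clause would turn the selectors into a clique, so the disjunction is cut into
    three-variable choices laid out along the tree. Since a node may have any number of children and
    clauses, each choice gets its own copy of the bag, and renewing the current variable at each
    choice keeps the number of new variables per copy constant. The implications go one way only:
    true variables in excess only add obligations, and since the last current variables are false,
    the token has to be taken by a clause. The dummy [d] brings every copy to exactly four new
    variables, so that the width is the required one and not just bounded by it, also when all bags
    are empty and [k] is -1. *)

Definition pbounded (q : nat -> nat) : Prop :=
  exists k, forall x, q x <= x.+2 ^ k.

Lemma pbounded_le q1 q2 : (forall x, q1 x <= q2 x) -> pbounded q2 -> pbounded q1.
Proof. by move=> le12 [k hk]; exists k => x; apply: leq_trans (hk x). Qed.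

Lemma pbounded_id : pbounded id.
Proof. by exists 1 => x; rewrite expn1; lia. Qed.

Lemma pbounded_const c : pbounded (fun => c).
Proof.
exists c => x; apply: leq_trans (ltnW (ltn_expl c (isT : 1 < 2))) _.
by case: c => [|c] //; rewrite leq_exp2r.
Qed.

Lemma pbounded_mul q1 q2 :
  pbounded q1 -> pbounded q2 -> pbounded (fun x => q1 x * q2 x).
Proof.
by move=> [k1 h1] [k2 h2]; exists (k1 + k2) => x; rewrite expnD leq_mul.
Qed.

(** The sum costs a factor 2, which one more power of [x.+2] pays for; the base is at least 2 even
    at [x = 0]. *)
Lemma pbounded_add q1 q2 :
  pbounded q1 -> pbounded q2 -> pbounded (fun x => q1 x + q2 x).
Proof.
move=> [k1 h1] [k2 h2]; exists (k1 + k2).+1 => x.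
apply: leq_trans (_ : 2 * x.+2 ^ (k1 + k2) <= _); last first.
  by rewrite expnS leq_mul2r orbT.
rewrite mul2n -addnn; apply: leq_add.
  by apply: leq_trans (h1 x) _; rewrite leq_exp2l // leq_addr.
by apply: leq_trans (h2 x) _; rewrite leq_exp2l // leq_addl.
Qed.

Lemma pbounded_succ q : pbounded q -> pbounded (fun x => (q x).+1).
Proof.
move=> hq; apply: pbounded_le (pbounded_add hq (pbounded_const 1)) => x.
by rewrite addn1.
Qed.

Lemma pbounded_exp q k : pbounded q -> pbounded (fun x => q x ^ k).
Proof.
move=> hq; elim: k => [|k IH]; first exact: pbounded_const.
by apply: pbounded_le (pbounded_mul hq IH) => x; rewrite expnS.
Qed.

Ltac pbound :=
  repeat first [ exact: pbounded_const | exact: pbounded_id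
               | apply: pbounded_add | apply: pbounded_mul
               | apply: pbounded_exp | apply: pbounded_succ ].

(** * Encodings determined by types *)

Class Enc (A : Type) := enc : A -> data.
Instance Enc_nat : Enc nat := enc_nat.
Instance Enc_bool : Enc bool := enc_bool.
Instance Enc_pair A B {eA : Enc A} {eB : Enc B} : Enc (A * B) := enc_pair enc enc.
Instance Enc_seq A {eA : Enc A} : Enc (seq A) := enc_seq enc.

Definition dsize {A} {eA : Enc A} (a : A) : nat := data_size (enc a).
Arguments dsize : simpl never.

Lemma data_size_gt0 d : 0 < data_size d.
Proof. by case: d. Qed.

Lemma dsize_gt0 A {eA : Enc A} (a : A) : 0 < dsize a.
Proof. exact: data_size_gt0. Qed.

Lemma dsize_pair A B {eA : Enc A} {eB : Enc B} (a : A) (b : B) :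
  dsize (a, b) = (dsize a + dsize b).+1.
Proof. by []. Qed.

Lemma dsize_cons A {eA : Enc A} (a : A) s :
  dsize (a :: s) = (dsize a + dsize s).+1.
Proof. by []. Qed.

Lemma dsize_cat A {eA : Enc A} (s1 s2 : seq A) :
  dsize (s1 ++ s2) = (dsize s1 + dsize s2).-1.
Proof.
elim: s1 => [|a s1 IH]; first by [].
have ? : 0 < dsize s1 by exact: dsize_gt0.
by rewrite cat_cons !dsize_cons IH; lia.
Qed.

Lemma size_le_dsize A {eA : Enc A} (s : seq A) : size s <= dsize s.
Proof. by elim: s => //= a s IH; rewrite dsize_cons; lia. Qed.

(** * Total correctness of programs with time bounds *)

Definition triple (s : store) (c : cmd) (T : nat) (Q : store -> Prop) : Prop :=
  exists s' t, [/\ exec s c s' t, Q s' & t <= T].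

Lemma triple_weaken s c T1 T2 (Q1 Q2 : store -> Prop) :
  triple s c T1 Q1 -> (forall s', Q1 s' -> Q2 s') -> T1 <= T2 -> triple s c T2 Q2.
Proof.
move=> [s' [t [ex q le]]] Q12 le12; exists s', t; split => //; first exact: Q12.
exact: leq_trans le12.
Qed.

Lemma triple_assign s x e T (Q : store -> Prop) :
  Q (update s x (eval s e)) -> cost s e < T -> triple s (Assign x e) T Q.
Proof.
move=> q le; exists (update s x (eval s e)), (cost s e).+1; split => //.
exact: ExecAssign.
Qed.

Lemma triple_seq s c1 c2 T1 T2 T (Q : store -> Prop) :
  triple s c1 T1 (fun s1 => triple s1 c2 T2 Q) -> T1 + T2 < T ->
  triple s (Defs.Seq c1 c2) T Q.
Proof.
move=> [s1 [t1 [ex1 [s2 [t2 [ex2 q le2]]] le1]]] le.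
exists s2, (t1 + t2).+1; split => //; first exact: ExecSeq ex2.
by lia.
Qed.

Lemma triple_if s e c1 c2 T1 T (Q : store -> Prop) :
  triple s (if truth (eval s e) then c1 else c2) T1 Q -> cost s e + T1 < T ->
  triple s (If e c1 c2) T Q.
Proof.
move=> [s1 [t1 [ex1 q le1]]] le; exists s1, (cost s e + t1).+1.
by split => //; [exact: ExecIf | lia].
Qed.

(** Every tree built is charged at its size, so a value cannot outgrow the time spent. Hence
    [polytime_size], the bound on intermediate results that composition relies on. *)
Lemma exec_size s c s' t :
  exec s c s' t -> forall y, data_size (s' y) <= data_size (s y) + t.
Proof.
elim=> {s c s' t} //=.
- by move=> s y; lia.
- move=> s x e y; rewrite /update; case: eqP => // _; last by lia.
  have : data_size (eval s e) <= cost s e by case: e => * /=; lia.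
  by lia.
- by move=> s c1 s1 t1 c2 s2 t2 _ h1 _ h2 y; have := h1 y; have := h2 y; lia.
- by move=> s e c1 c2 s' t _ h y; have := h y; lia.
- by move=> s e c _ y; lia.
- by move=> s e c s1 t1 s2 t2 _ _ h1 _ h2 y; have := h1 y; have := h2 y; lia.
Qed.

(* The result must not depend on the initial contents of the other variables,
   and the variables from n on are untouched: a program using this one can
   save its own data there. *)
Definition computes {A B} {eA : Enc A} {eB : Enc B} (f : A -> B)
    (c : cmd) (n : nat) (q : nat -> nat) : Prop :=
  forall s a, s 0 = enc a ->
    triple s c (q (dsize a))
      (fun s' => s' 0 = enc (f a) /\ forall y, n <= y -> s' y = s y).

Definition polytime {A B} {eA : Enc A} {eB : Enc B} (f : A -> B) : Prop :=
  exists c n q, pbounded q /\ computes f c n q.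

Lemma polytime_size A B {eA : Enc A} {eB : Enc B} (f : A -> B) :
  polytime f -> exists k, forall a, dsize (f a) <= (dsize a).+2 ^ k.
Proof.
move=> [c [n [q [pq hc]]]].
have [k hk] : pbounded (fun x => x + q x) by apply: pbounded_add pq; exact: pbounded_id.
exists k => a; apply: leq_trans (hk _).
have [s' [t [ex [e _] le]]] := hc (fun => enc a) a erefl.
by move: le (exec_size ex 0); rewrite e /dsize; lia.
Qed.

Lemma polytimeE A B {eA : Enc A} {eB : Enc B} (f : A -> B) :
  polytime f -> exists c n k,
    computes f c n (fun x => x.+2 ^ k) /\ forall a, dsize (f a) <= (dsize a).+2 ^ k.
Proof.
move=> hf; have [c [n [q [[k1 h1] hc]]]] := hf; have [k2 h2] := polytime_size hf.
exists c, n, (k1 + k2); split=> [s a e|a].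
  apply: triple_weaken (hc s a e) _ _ => //.
  by apply: leq_trans (h1 _) _; rewrite leq_exp2l // leq_addr.
by apply: leq_trans (h2 _) _; rewrite leq_exp2l // leq_addl.
Qed.

Lemma polytime_ext A B {eA : Enc A} {eB : Enc B} (f g : A -> B) :
  (forall a, f a = g a) -> polytime f -> polytime g.
Proof.
move=> fg [c [n [q [pq hc]]]]; exists c, n, q; split => // s a e.
by rewrite -fg; exact: hc.
Qed.

(** A program sees only encodings. In this way a number is exchanged for its list of bits, and a
    list for the pair of its head and tail. *)
Lemma polytime_recode A B C {eA : Enc A} {eB : Enc B} {eC : Enc C}
    (f : A -> B) (g : A -> C) :
  (forall a, enc (f a) = enc (g a)) -> polytime f -> polytime g.
Proof.
move=> fg [c [n [q [pq hc]]]]; exists c, n, q; split => // s a e.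
by rewrite -fg; exact: hc.
Qed.

Lemma polytime_assign A B {eA : Enc A} {eB : Enc B} (f : A -> B) e q :
  pbounded q ->
  (forall s a, s 0 = enc a -> eval s e = enc (f a) /\ cost s e < q (dsize a)) ->
  polytime f.
Proof.
move=> pq h; exists (Assign 0 e), 1, q; split=> // s a es.
have [ev co] := h s a es.
apply: triple_assign => //; split; first by rewrite /update eqxx.
by move=> [|y].
Qed.

Lemma polytime_id A {eA : Enc A} : polytime (fun a : A => a).
Proof.
apply: (@polytime_assign _ _ _ _ _ (Var 0) (fun x => x.+1)); first by pbound.
by move=> s a e /=; rewrite e addn0.
Qed.

Lemma polytime_fst A B {eA : Enc A} {eB : Enc B} : polytime (@fst A B).
Proof.
apply: (@polytime_assign _ _ _ _ _ (Head (Var 0)) (fun x => (x + x).+1)).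
  by pbound.
move=> s [a b] /= -> /=; split => //; rewrite dsize_pair /dsize /=; lia.
Qed.

Lemma polytime_snd A B {eA : Enc A} {eB : Enc B} : polytime (@snd A B).
Proof.
apply: (@polytime_assign _ _ _ _ _ (Tail (Var 0)) (fun x => (x + x).+1)).
  by pbound.
move=> s [a b] /= -> /=; split => //; rewrite dsize_pair /dsize /=; lia.
Qed.

Fixpoint quote (d : data) : expr :=
  if d is Node d1 d2 then Defs.Cons (quote d1) (quote d2) else Defs.Nil.

Lemma eval_quote s d : eval s (quote d) = d.
Proof. by elim: d => //= d1 -> d2 ->. Qed.

Lemma cost_quote s s' d : cost s (quote d) = cost s' (quote d).
Proof. by elim: d => //= d1 -> d2 ->; rewrite !eval_quote. Qed.

Lemma polytime_const A B {eA : Enc A} {eB : Enc B} (b : B) :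
  polytime (fun _ : A => b).
Proof.
apply: (@polytime_assign _ _ _ _ _ (quote (enc b))
  (fun => (cost (fun => Leaf) (quote (enc b))).+1)); first by pbound.
by move=> s a _; rewrite eval_quote (cost_quote _ (fun => Leaf)).
Qed.

Lemma polytime_comp A B C {eA : Enc A} {eB : Enc B} {eC : Enc C}
    (g : B -> C) (f : A -> B) :
  polytime g -> polytime f -> polytime (fun a => g (f a)).
Proof.
move=> /polytimeE [cg [ng [kg [hg sg]]]] /polytimeE [cf [nf [kf [hf sf]]]].
exists (Defs.Seq cf cg), (maxn nf ng),
  (fun x => (x.+2 ^ kf + (x.+2 ^ kf).+2 ^ kg).+1); split; first by pbound.
move=> s a es; apply: (@triple_seq _ _ _ ((dsize a).+2 ^ kf) ((dsize (f a)).+2 ^ kg)).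
  apply: triple_weaken (hf s a es) _ _ => // s1 [e1 fr1].
  apply: triple_weaken (hg s1 _ e1) _ _ => // s2 [e2 fr2]; split => // y hy.
  by rewrite fr2 ?fr1 //; lia.
rewrite ltnS leq_add2l; case: kg {hg sg} => // k.
by rewrite leq_exp2r // !ltnS.
Qed.

Lemma update_eq s x d : update s x d x = d.
Proof. by rewrite /update eqxx. Qed.

Lemma update_neq s x d y : y != x -> update s x d y = s y.
Proof. by rewrite /update => /negbTE ->. Qed.

Lemma polytime_pair A B C {eA : Enc A} {eB : Enc B} {eC : Enc C}
    (f : A -> B) (g : A -> C) :
  polytime f -> polytime g -> polytime (fun a => (f a, g a)).
Proof.
move=> /polytimeE [cf [nf [kf [hf sf]]]] /polytimeE [cg [ng [kg [hg sg]]]].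
(* Neither program touches the variables from [n] on: [n] saves the input, [n.+1] the first
   result. *)
pose n := (maxn nf ng).+1.
exists (Defs.Seq (Assign n (Var 0)) (Defs.Seq cf (Defs.Seq (Assign n.+1 (Var 0))
         (Defs.Seq (Assign 0 (Var n)) (Defs.Seq cg
         (Assign 0 (Defs.Cons (Var n.+1) (Var 0)))))))), n.+2,
  (fun x => 20 + 10 * x + 10 * x.+2 ^ kf + 10 * x.+2 ^ kg); split; first by pbound.
move=> s a es; have szf := sf a; have szg := sg a.
have ex : data_size (enc a) = dsize a by [].
move: (dsize a) ex szf szg => x ex szf szg.
apply: (@triple_seq _ _ _ x.+1 (18 + 8 * x + 10 * x.+2 ^ kf + 10 * x.+2 ^ kg));
  last by lia.
apply: triple_assign; last by rewrite /= es ex; lia.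
set s1 := update _ _ _.
apply: (@triple_seq _ _ _ (x.+2 ^ kf) (16 + 6 * x + 7 * x.+2 ^ kf + 10 * x.+2 ^ kg));
  last by lia.
have e1 : s1 0 = enc a by rewrite /s1 update_neq.
have := hf s1 a e1; rewrite /dsize ex => h.
apply: triple_weaken h _ _ => // s2 [e2 fr2].
apply: (@triple_seq _ _ _ (dsize (f a)).+1 (14 + 6 * x + 4 * x.+2 ^ kf + 10 * x.+2 ^ kg));
  last by move: szf; lia.
apply: triple_assign; last by rewrite /= e2 /dsize; lia.
set s3 := update _ _ _.
have e3 : s3 n = enc a.
  by rewrite /s3 update_neq ?fr2 /s1 ?update_eq //; rewrite /n; lia.
apply: (@triple_seq _ _ _ x.+1 (12 + 4 * x + 4 * x.+2 ^ kf + 10 * x.+2 ^ kg));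
  last by lia.
apply: triple_assign; last by rewrite /= e3 ex; lia.
set s4 := update _ _ _.
have e4 : s4 0 = enc a by rewrite /s4 update_eq.
apply: (@triple_seq _ _ _ (x.+2 ^ kg) (10 + 2 * x + 4 * x.+2 ^ kf + 8 * x.+2 ^ kg));
  last by lia.
have := hg s4 a e4; rewrite /dsize ex => h4.
apply: triple_weaken h4 _ _ => // s5 [e5 fr5].
have e5' : s5 n.+1 = enc (f a).
  by rewrite fr5 /s4 ?update_neq /s3 ?update_eq /= ?e2 //; rewrite /n; lia.
apply: triple_assign.
  split; first by rewrite update_eq /= e5 e5'.
  move=> y hy; rewrite update_neq; last by lia.
  rewrite fr5 /s4 ?update_neq /s3 ?update_neq ?fr2 /s1 ?update_neq //;
    rewrite /n in hy *; lia.
rewrite /= e5 e5'; move: szf szg; rewrite /dsize; lia.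
Qed.

Lemma polytime_cons A B {eA : Enc A} {eB : Enc B} (f : A -> B) (g : A -> seq B) :
  polytime f -> polytime g -> polytime (fun a => f a :: g a).
Proof. by move=> hf hg; apply: polytime_recode (polytime_pair hf hg). Qed.

Lemma polytime_if A B {eA : Enc A} {eB : Enc B} (b : A -> bool) (f g : A -> B) :
  polytime b -> polytime f -> polytime g ->
  polytime (fun a => if b a then f a else g a).
Proof.
move=> /polytimeE [cb [nb [kb [hb sb]]]] /polytimeE [cf [nf [kf [hf sf]]]].
move=> /polytimeE [cg [ng [kg [hg sg]]]].
pose n := (maxn nb (maxn nf ng)).+1.
exists (Defs.Seq (Assign n (Var 0)) (Defs.Seq cb
         (If (Var 0) (Defs.Seq (Assign 0 (Var n)) cf)
                     (Defs.Seq (Assign 0 (Var n)) cg)))), n.+1,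
  (fun x => 20 + 10 * x + 10 * x.+2 ^ kb + 10 * x.+2 ^ kf + 10 * x.+2 ^ kg).
split; first by pbound.
move=> s a es; have szb := sb a.
have ex : data_size (enc a) = dsize a by [].
move: (dsize a) ex szb => x ex szb.
apply: (@triple_seq _ _ _ x.+1
  (18 + 8 * x + 10 * x.+2 ^ kb + 10 * x.+2 ^ kf + 10 * x.+2 ^ kg)); last by lia.
apply: triple_assign; last by rewrite /= es ex; lia.
set s1 := update _ _ _.
apply: (@triple_seq _ _ _ (x.+2 ^ kb)
  (16 + 6 * x + 7 * x.+2 ^ kb + 10 * x.+2 ^ kf + 10 * x.+2 ^ kg)); last by lia.
have e1 : s1 0 = enc a by rewrite /s1 update_neq.
have := hb s1 a e1; rewrite /dsize ex => h.
apply: triple_weaken h _ _ => // s2 [e2 fr2].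
have e2n : s2 n = enc a by rewrite fr2 /s1 ?update_eq //= /n; lia.
apply: (@triple_if _ _ _ _ (10 + 6 * x + 10 * x.+2 ^ kf + 10 * x.+2 ^ kg));
  last by rewrite /= e2; move: szb; rewrite /dsize; lia.
have branch (h : A -> B) ch nh kh : computes h ch nh (fun x => x.+2 ^ kh) ->
    nh <= n -> x.+2 ^ kh <= x.+2 ^ kf + x.+2 ^ kg ->
    triple s2 (Defs.Seq (Assign 0 (Var n)) ch)
      (10 + 6 * x + 10 * x.+2 ^ kf + 10 * x.+2 ^ kg)
      (fun s' => s' 0 = enc (h a) /\ forall y, n.+1 <= y -> s' y = s y).
  move=> hh nhn le; apply: (@triple_seq _ _ _ x.+1 (x.+2 ^ kh)); last by lia.
  apply: triple_assign; last by rewrite /= e2n ex; lia.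
  set s3 := update _ _ _.
  have e3 : s3 0 = enc a by rewrite /s3 update_eq.
  have := hh s3 a e3; rewrite /dsize ex => h3.
  apply: triple_weaken h3 _ _ => // s4 [e4 fr4]; split => // y hy.
  rewrite fr4 /s3 ?update_neq ?fr2 /s1 ?update_neq //;
    rewrite /n in hy nhn *; lia.
have -> : truth (eval s2 (Var 0)) = b a by rewrite /= e2; case: (b a).
by case: (b a); [apply: branch hf _ _ | apply: branch hg _ _]; rewrite /n; lia.
Qed.

Lemma data_eqP d e : data_eq d e = true <-> d = e.
Proof.
elim: d e => [|d1 IH1 d2 IH2] [|e1 e2] //=; split=> //.
  by case/andP => /IH1 -> /IH2 ->.
by case=> <- <-; apply/andP; split; [apply/IH1 | apply/IH2].
Qed.

Lemma polytime_eq A (B : eqType) {eA : Enc A} {eB : Enc B} (f g : A -> B) :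
  injective (enc : B -> data) ->
  polytime f -> polytime g -> polytime (fun a => f a == g a).
Proof.
move=> inj hf hg.
apply: (@polytime_comp _ _ _ _ _ _ (fun p : B * B => p.1 == p.2) _ _
  (polytime_pair hf hg)).
apply: (@polytime_assign _ _ _ _ _ (Equal (Head (Var 0)) (Tail (Var 0)))
  (fun x => 10 + 10 * x)); first by pbound.
move=> s [a b] /= -> /=; split.
  congr enc_bool; apply/idP/eqP => [/data_eqP /inj //|->]; exact/data_eqP.
rewrite dsize_pair /dsize /=.
by case: (data_eq _ _) => /=; lia.
Qed.

Lemma enc_cons X {eX : Enc X} (b : X) l : enc (b :: l) = Node (enc b) (enc l).
Proof. by []. Qed.

(** The accumulator has to be bounded at every prefix of the list: a step that doubles its
    accumulator takes polynomial time, but its iteration does not. *)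
Lemma polytime_foldl A X S {eA : Enc A} {eX : Enc X} {eS : Enc S}
    (step : A -> S -> X -> S) (init : A -> S) (l : A -> seq X) :
  polytime (fun z : (A * S) * X => step z.1.1 z.1.2 z.2) ->
  polytime init -> polytime l ->
  (exists k, forall a l1 l2, l a = l1 ++ l2 ->
     dsize (foldl (step a) (init a) l1) <= (dsize a).+2 ^ k) ->
  polytime (fun a => foldl (step a) (init a) (l a)).
Proof.
move=> /polytimeE [cs [ns [ks [hs _]]]] /polytimeE [ci [ni [ki [hi si]]]].
move=> /polytimeE [cl [nl [kl [hl sl]]]] [k hk].
pose n := (maxn ns (maxn ni nl)).+1.
(* [n] holds the input, [n.+1] the accumulator and [n.+2] the elements still to come; variable 0
   carries the argument and the result of [cs]. *)
pose body := Defs.Seq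
  (Assign 0 (Defs.Cons (Defs.Cons (Var n) (Var n.+1)) (Head (Var n.+2))))
  (Defs.Seq cs (Defs.Seq (Assign n.+1 (Var 0)) (Assign n.+2 (Tail (Var n.+2))))).
pose bnd x := x + x.+2 ^ kl + x.+2 ^ k.
(* The argument of [cs] has two pair nodes beyond its three components, and the time bound of [cs]
   adds 2 to the size: hence [.+4]. *)
pose iter x := 30 + 20 * bnd x + ((bnd x).+4) ^ ks.
have loop x a (ex : data_size (enc a) = x) (sla : dsize (l a) <= x.+2 ^ kl) l2 :
    forall l1 s, l a = l1 ++ l2 ->
      s n = enc a -> s n.+1 = enc (foldl (step a) (init a) l1) -> s n.+2 = enc l2 ->
    triple s (While (Var n.+2) body) ((size l2).+1 * iter x).+1
      (fun s' => s' n.+1 = enc (foldl (step a) (init a) (l a)) /\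
         forall y, n.+3 <= y -> s' y = s y).
  elim: l2 => [|b l2 IH] l1 s el e0 e1 e2.
    rewrite cats0 in el; exists s, (cost s (Var n.+2)).+1; split.
    - by apply: ExecWhileStop; rewrite /= e2.
    - by rewrite e1 el.
    - by rewrite /= e2 /iter /= mul1n; lia.
  have hb : triple s body (20 + 10 * bnd x + ((bnd x).+4) ^ ks) (fun s' =>
      [/\ s' n = enc a, s' n.+1 = enc (foldl (step a) (init a) (rcons l1 b)),
          s' n.+2 = enc l2 & forall y, n.+3 <= y -> s' y = s y]).
    have sb : data_size (enc b) + data_size (enc l2) < x.+2 ^ kl.
      have pos : 0 < dsize l1 by exact: dsize_gt0.
      by apply: leq_trans sla; move: pos; rewrite el dsize_cat dsize_cons /dsize; lia.
    have ss := hk a l1 (b :: l2) el; rewrite /dsize ex in ss.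
    have ss' := hk a (rcons l1 b) l2; rewrite cat_rcons in ss'.
    have {ss'} := ss' el; rewrite /dsize ex => ss'.
    have sz : dsize ((a, foldl (step a) (init a) l1), b) <= (bnd x).+2.
      rewrite !dsize_pair /dsize ex /bnd; lia.
    apply: (@triple_seq _ _ _ (10 + 5 * bnd x)
      (8 + 5 * bnd x + ((bnd x).+4) ^ ks)); last by lia.
    apply: triple_assign; last by rewrite /= e0 e1 e2 enc_cons /= ex /bnd; lia.
    set s1 := update _ _ _.
    apply: (@triple_seq _ _ _ (((bnd x).+4) ^ ks) (7 + 4 * bnd x)); last by lia.
    have es1 : s1 0 = enc ((a, foldl (step a) (init a) l1), b).
      by rewrite /s1 update_eq /= e0 e1 e2.
    have h := hs s1 _ es1.
    apply: triple_weaken h _ _ => [s2 [/= es2 fr2]|]; last first.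
      case: (ks) => // ks'; rewrite leq_exp2r // !ltnS; lia.
    apply: (@triple_seq _ _ _ (1 + bnd x) (4 + 3 * bnd x)); last by lia.
    apply: triple_assign.
      set s3 := update _ _ _.
      have e32 : s3 n.+2 = enc (b :: l2).
        rewrite /s3 update_neq ?fr2 /s1 ?update_neq ?e2 //; rewrite /n; lia.
      apply: triple_assign; last by rewrite /= e32 enc_cons /= /bnd; lia.
      split.
      - rewrite update_neq /s3 ?update_neq ?fr2 /s1 ?update_neq //; rewrite /n; lia.
      - by rewrite update_neq /s3 ?update_eq ?foldl_rcons ?neq_ltn ?ltnSn.
      - by rewrite update_eq /= e32.
      - move=> y hy.
        rewrite update_neq /s3 ?update_neq ?fr2 /s1 ?update_neq //;
          rewrite /n in hy *; lia.
    rewrite /= es2 -foldl_rcons; move: ss'; rewrite /bnd; lia.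
  have [s1 [t1 [ex1 [f0 f1 f2 f3] le1]]] := hb.
  have el' : l a = rcons l1 b ++ l2 by rewrite cat_rcons.
  have [s2 [t2 [ex2 [g1 g2] le2]]] := IH _ _ el' f0 f1 f2.
  exists s2, (cost s (Var n.+2) + t1 + t2).+1; split.
  - by apply: ExecWhileLoop ex1 ex2; rewrite /= e2.
  - by split => // y hy; rewrite g2 ?f3.
  - rewrite /= e2 in le1 le2 *.
    have sb : data_size (enc (b :: l2)) <= x.+2 ^ kl.
      have pos : 0 < dsize l1 by exact: dsize_gt0.
      by apply: leq_trans sla; move: pos; rewrite el dsize_cat /dsize; lia.
    have itE : iter x = 30 + 20 * bnd x + (bnd x).+4 ^ ks by [].
    have -> : (size (b :: l2)).+1 * iter x = iter x + (size l2).+1 * iter x.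
      by rewrite mulSn.
    move: le2; set w := _.+1 * iter x => le2; rewrite itE.
    by move: w le2 => w le2; rewrite /bnd; rewrite /bnd in le1; lia.
exists (Defs.Seq (Assign n (Var 0)) (Defs.Seq ci (Defs.Seq (Assign n.+1 (Var 0))
         (Defs.Seq (Assign 0 (Var n)) (Defs.Seq cl (Defs.Seq (Assign n.+2 (Var 0))
         (Defs.Seq (While (Var n.+2) body) (Assign 0 (Var n.+1))))))))), n.+3,
  (fun x => 40 + 10 * x + 10 * x.+2 ^ ki + 10 * x.+2 ^ kl + 10 * x.+2 ^ k
            + (x.+2 ^ kl).+1 * iter x).
split; first by rewrite /iter /bnd; pbound.
move=> s a es; have szi := si a; have szl := sl a; have szf := hk a (l a) [::].
rewrite cats0 in szf; have {}szf := szf erefl.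
have ex : data_size (enc a) = dsize a by [].
move: (dsize a) ex szi szl szf => x ex szi szl szf.
apply: (@triple_seq _ _ _ x.+1 (38 + 9 * x + 10 * x.+2 ^ ki + 10 * x.+2 ^ kl
  + 10 * x.+2 ^ k + (x.+2 ^ kl).+1 * iter x)); last by lia.
apply: triple_assign; last by rewrite /= es ex; lia.
set s1 := update _ _ _.
have e1 : s1 0 = enc a by rewrite /s1 update_neq.
apply: (@triple_seq _ _ _ (x.+2 ^ ki) (36 + 9 * x + 8 * x.+2 ^ ki + 10 * x.+2 ^ kl
  + 10 * x.+2 ^ k + (x.+2 ^ kl).+1 * iter x)); last by lia.
have := hi s1 a e1; rewrite /dsize ex => h.
apply: triple_weaken h _ _ => // s2 [e2 fr2].
apply: (@triple_seq _ _ _ (x.+2 ^ ki).+1 (34 + 9 * x + 10 * x.+2 ^ kl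
  + 10 * x.+2 ^ k + (x.+2 ^ kl).+1 * iter x)); last by lia.
apply: triple_assign; last by rewrite /= e2; move: szi; rewrite /dsize; lia.
set s3 := update _ _ _.
have e3 : s3 n = enc a.
  by rewrite /s3 update_neq ?fr2 /s1 ?update_eq //; rewrite /n; lia.
apply: (@triple_seq _ _ _ x.+1 (32 + 8 * x + 10 * x.+2 ^ kl
  + 10 * x.+2 ^ k + (x.+2 ^ kl).+1 * iter x)); last by lia.
apply: triple_assign; last by rewrite /= e3 ex; lia.
set s4 := update _ _ _.
have e4 : s4 0 = enc a by rewrite /s4 update_eq /= e3.
apply: (@triple_seq _ _ _ (x.+2 ^ kl) (30 + 8 * x + 9 * x.+2 ^ kl
  + 10 * x.+2 ^ k + (x.+2 ^ kl).+1 * iter x)); last by lia.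
have := hl s4 a e4; rewrite /dsize ex => h4.
apply: triple_weaken h4 _ _ => // s5 [e5 fr5].
apply: (@triple_seq _ _ _ (x.+2 ^ kl).+1 (28 + 8 * x + 8 * x.+2 ^ kl
  + 10 * x.+2 ^ k + (x.+2 ^ kl).+1 * iter x)); last by lia.
apply: triple_assign; last by rewrite /= e5; move: szl; rewrite /dsize; lia.
set s6 := update _ _ _.
have fr6 y : n <= y -> s6 y = if y == n.+2 then enc (l a) else
    if y == n.+1 then enc (init a) else if y == n then enc a else s y.
  move=> hy; rewrite /s6 /update /= e5; case: eqP => // _.
  rewrite fr5 ?/s4 ?update_neq ?/s3; try (rewrite /n in hy *; lia).
  rewrite /update /= e2; case: eqP => // _.
  rewrite fr2 ?/s1 /update /= ?es //; rewrite /n in hy *; lia.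
apply: (@triple_seq _ _ _ ((x.+2 ^ kl).+1 * iter x).+1 (10 + x.+2 ^ k)); last by lia.
have h6 := loop x a ex szl (l a) [::] s6 erefl.
apply: triple_weaken (h6 _ _ _) _ _.
- by rewrite fr6 // (ltn_eqF (_ : n < n.+2)) // (ltn_eqF (_ : n < n.+1)) // eqxx.
- by rewrite fr6 // (ltn_eqF (_ : n.+1 < n.+2)) // eqxx.
- by rewrite fr6 ?eqxx //; lia.
- move=> s7 [e7 fr7]; apply: triple_assign.
    split; first by rewrite update_eq.
    move=> y hy; rewrite update_neq ?fr7 ?fr6; try lia.
    have [-> -> ->] : [/\ (y == n.+2) = false, (y == n.+1) = false & (y == n) = false].
      by split; lia.
    by [].
  by rewrite /= e7; move: szf; rewrite /dsize; lia.
- rewrite ltnS leq_mul2r ltnS; apply/orP; right.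
  apply: leq_trans szl; exact: size_le_dsize.
Qed.

(** The number of steps is at most the size of the list, so polynomial summands add up to a
    polynomial. [Inv] serves steps whose growth is bounded in this way only on accumulators that
    actually arise. *)
Lemma polytime_foldl_inv A X S {eA : Enc A} {eX : Enc X} {eS : Enc S}
    (Inv : A -> seq X -> S -> Prop)
    (step : A -> S -> X -> S) (init : A -> S) (l : A -> seq X) :
  polytime (fun z : (A * S) * X => step z.1.1 z.1.2 z.2) ->
  polytime init -> polytime l ->
  (forall a, Inv a [::] (init a)) ->
  (exists k, forall a l1 x l2 s, l a = l1 ++ x :: l2 -> Inv a l1 s ->
     Inv a (rcons l1 x) (step a s x) /\
     dsize (step a s x) <= dsize s + (dsize a + dsize x).+2 ^ k) ->
  polytime (fun a => foldl (step a) (init a) (l a)).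
Proof.
move=> hs hi hl inv0 [k hk]; apply: polytime_foldl => //.
have [ki si] := polytime_size hi; have [kl sl] := polytime_size hl.
have [k' hk'] : pbounded (fun x => x.+2 ^ ki +
    x.+2 ^ kl * (x + x.+2 ^ kl).+2 ^ k) by pbound.
exists k' => a l1 l2 el; apply: leq_trans (hk' _).
have bnd : Inv a l1 (foldl (step a) (init a) l1) /\
    dsize (foldl (step a) (init a) l1) <= dsize (init a) +
      size l1 * (dsize a + dsize (l a)).+2 ^ k.
  elim/last_ind: l1 l2 el => [|l1 x IH] l2 el; first by split => //=; lia.
  rewrite cat_rcons in el; have [iv le] := IH _ el.
  have [iv' le'] := hk _ _ _ _ _ el iv; rewrite foldl_rcons; split => //.
  apply: leq_trans le' _; rewrite size_rcons mulSn.
  have sx : dsize x <= dsize (l a).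
    have : 0 < dsize l1 by exact: dsize_gt0.
    by rewrite el dsize_cat dsize_cons; lia.
  have : (dsize a + dsize x).+2 ^ k <= (dsize a + dsize (l a)).+2 ^ k.
    by case: (k) => // k0; rewrite leq_exp2r //; lia.
  by lia.
apply: leq_trans bnd.2 _; apply: leq_add; first exact: si.
apply: leq_mul.
  apply: leq_trans (sl a); apply: leq_trans (size_le_dsize (l a)).
  by rewrite el size_cat leq_addr.
by case: (k) => // k0; rewrite leq_exp2r // !ltnS leq_add2l; exact: sl.
Qed.

Lemma polytime_foldl_incr A X S {eA : Enc A} {eX : Enc X} {eS : Enc S}
    (step : A -> S -> X -> S) (init : A -> S) (l : A -> seq X) :
  polytime (fun z : (A * S) * X => step z.1.1 z.1.2 z.2) ->
  polytime init -> polytime l ->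
  (exists k, forall a s x,
     dsize (step a s x) <= dsize s + (dsize a + dsize x).+2 ^ k) ->
  polytime (fun a => foldl (step a) (init a) (l a)).
Proof.
move=> hs hi hl [k hk].
by apply: (@polytime_foldl_inv _ _ _ _ _ _ (fun _ _ _ => True)) => //; exists k.
Qed.

Lemma polytime_fst_of A B C {eA : Enc A} {eB : Enc B} {eC : Enc C} (f : A -> B * C) :
  polytime f -> polytime (fun a => (f a).1).
Proof. exact: (polytime_comp (@polytime_fst B C _ _)). Qed.

Lemma polytime_snd_of A B C {eA : Enc A} {eB : Enc B} {eC : Enc C} (f : A -> B * C) :
  polytime f -> polytime (fun a => (f a).2).
Proof. exact: (polytime_comp (@polytime_snd B C _ _)). Qed.

Lemma polytime_andb A {eA : Enc A} (f g : A -> bool) :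
  polytime f -> polytime g -> polytime (fun a => f a && g a).
Proof. by move=> hf hg; exact: (polytime_if hf hg (@polytime_const _ _ _ _ false)). Qed.

Lemma polytime_orb A {eA : Enc A} (f g : A -> bool) :
  polytime f -> polytime g -> polytime (fun a => f a || g a).
Proof. by move=> hf hg; exact: (polytime_if hf (@polytime_const _ _ _ _ true) hg). Qed.

Lemma polytime_negb A {eA : Enc A} (f : A -> bool) :
  polytime f -> polytime (fun a => ~~ f a).
Proof.
by move=> hf; exact:
  (polytime_if hf (@polytime_const _ _ _ _ false) (@polytime_const _ _ _ _ true)).
Qed.

Lemma polytime_addb A {eA : Enc A} (f g : A -> bool) :
  polytime f -> polytime g -> polytime (fun a => f a (+) g a).
Proof. move=> hf hg; apply: polytime_ext (polytime_if hf (polytime_negb hg) hg) => a.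
by case: (f a). Qed.

Lemma polytime_rev A X {eA : Enc A} {eX : Enc X} (l : A -> seq X) :
  polytime l -> polytime (fun a => rev (l a)).
Proof.
move=> hl; apply: (@polytime_ext _ _ _ _ (fun a => foldl (fun s x => x :: s) [::] (l a))).
  move=> a; rewrite -[RHS]cats0 -catrevE.
  by elim: (l a) [::] => //= x s IH t; rewrite IH.
apply: polytime_foldl_incr => //.
- apply: polytime_cons; first exact: polytime_snd.
  by apply: polytime_snd_of; apply: polytime_fst.
- exact: polytime_const.
- by exists 1 => a s x; rewrite dsize_cons expn1; lia.
Qed.

Lemma polytime_cat A X {eA : Enc A} {eX : Enc X} (l1 l2 : A -> seq X) :
  polytime l1 -> polytime l2 -> polytime (fun a => l1 a ++ l2 a).
Proof.
move=> h1 h2.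
apply: (@polytime_ext _ _ _ _ (fun a => foldl (fun s x => x :: s) (l2 a) (rev (l1 a)))).
  move=> a; elim/last_ind: (l1 a) (l2 a) => //= s x IH t.
  by rewrite rev_rcons /= IH cat_rcons.
apply: polytime_foldl_incr => //.
- apply: polytime_cons; first exact: polytime_snd.
  by apply: polytime_snd_of; apply: polytime_fst.
- exact: polytime_rev.
- by exists 1 => a s x; rewrite dsize_cons expn1; lia.
Qed.

Lemma polytime_rcons A X {eA : Enc A} {eX : Enc X} (l : A -> seq X) (x : A -> X) :
  polytime l -> polytime x -> polytime (fun a => rcons (l a) (x a)).
Proof.
move=> hl hx; apply: (@polytime_ext _ _ _ _ (fun a => l a ++ [:: x a])).
  by move=> a; rewrite cats1.
by apply: polytime_cat hl (polytime_cons hx (@polytime_const _ _ _ _ _)).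
Qed.

Lemma polytime_map A X Y {eA : Enc A} {eX : Enc X} {eY : Enc Y}
    (f : A -> X -> Y) (l : A -> seq X) :
  polytime (fun z : A * X => f z.1 z.2) -> polytime l ->
  polytime (fun a => [seq f a x | x <- l a]).
Proof.
move=> hf hl.
apply: (@polytime_ext _ _ _ _
  (fun a => rev (foldl (fun s x => f a x :: s) [::] (l a)))).
  move=> a; rewrite -[RHS](revK); congr rev; rewrite -[RHS]cats0 -catrevE.
  by elim: (l a) [::] => //= x s IH t; rewrite IH.
apply: polytime_rev; apply: (@polytime_foldl_incr _ _ _ _ _ _
  (fun a s x => f a x :: s)) => //.
- apply: polytime_cons; last by apply: polytime_snd_of; apply: polytime_fst.
  apply: (@polytime_comp _ _ _ _ _ _ _ (fun z : (A * seq Y) * X => (z.1.1, z.2)) hf).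
  apply: polytime_pair (@polytime_snd _ _ _ _).
  by apply: polytime_fst_of; exact: polytime_fst.
- exact: polytime_const.
- have [k hk] := polytime_size hf.
  have [k' hk'] : pbounded (fun x => (x.+1.+2 ^ k).+1) by pbound.
  exists k' => a s x; apply: leq_trans (_ : dsize s + (dsize (f a x)).+1 <= _).
    by rewrite dsize_cons; lia.
  rewrite leq_add2l; apply: leq_trans (hk' _); rewrite ltnS; exact: (hk (a, x)).
Qed.

Lemma polytime_flatten A X {eA : Enc A} {eX : Enc X} (l : A -> seq (seq X)) :
  polytime l -> polytime (fun a => flatten (l a)).
Proof.
move=> hl.
apply: (@polytime_ext _ _ _ _ (fun a => foldl (fun s x => x ++ s) [::] (rev (l a)))).
  move=> a; rewrite -[RHS]cats0; elim/last_ind: (l a) [::] => //= s x IH t.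
  by rewrite rev_rcons /= IH flatten_rcons catA.
apply: (@polytime_foldl_incr _ _ _ _ _ _ (fun _ s x => x ++ s)).
- apply: polytime_cat; first exact: polytime_snd.
  by apply: polytime_snd_of; apply: polytime_fst.
- exact: polytime_const.
- exact: polytime_rev.
- by exists 1 => a s x; rewrite dsize_cat expn1; lia.
Qed.

Lemma polytime_filter A X {eA : Enc A} {eX : Enc X}
    (p : A -> X -> bool) (l : A -> seq X) :
  polytime (fun z : A * X => p z.1 z.2) -> polytime l ->
  polytime (fun a => [seq x <- l a | p a x]).
Proof.
move=> hp hl.
apply: (@polytime_ext _ _ _ _ (fun a =>
  flatten [seq if p a x then [:: x] else [::] | x <- l a])).
  by move=> a; elim: (l a) => //= x s ->; case: (p a x).
apply: polytime_flatten; apply: polytime_map => //; apply: polytime_if => //.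
  by apply: polytime_cons (@polytime_const _ _ _ _ _); apply: polytime_snd.
exact: polytime_const.
Qed.

Lemma polytime_has A X {eA : Enc A} {eX : Enc X}
    (p : A -> X -> bool) (l : A -> seq X) :
  polytime (fun z : A * X => p z.1 z.2) -> polytime l ->
  polytime (fun a => has (p a) (l a)).
Proof.
move=> hp hl.
apply: (@polytime_ext _ _ _ _ (fun a => foldl (fun b x => b || p a x) false (l a))).
  move=> a; rewrite -[RHS]/(false || has (p a) (l a)).
  by elim: (l a) false => [|x s IH] b /=; [rewrite orbF | rewrite IH orbA].
apply: (@polytime_foldl_incr _ _ _ _ _ _ (fun a b x => b || p a x)) => //.
- apply: polytime_orb; first by apply: polytime_snd_of; apply: polytime_fst.
  apply: (@polytime_comp _ _ _ _ _ _ _ (fun z : (A * bool) * X => (z.1.1, z.2)) hp).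
  apply: polytime_pair (@polytime_snd _ _ _ _).
  by apply: polytime_fst_of; exact: polytime_fst.
- exact: polytime_const.
- exists 1 => a s x; rewrite expn1; have : dsize (s || p a x) <= 3.
    by case: (s || p a x).
  by have : 0 < dsize s by [case: s]; have : 0 < dsize x by [exact: dsize_gt0]; lia.
Qed.

Lemma polytime_all A X {eA : Enc A} {eX : Enc X}
    (p : A -> X -> bool) (l : A -> seq X) :
  polytime (fun z : A * X => p z.1 z.2) -> polytime l ->
  polytime (fun a => all (p a) (l a)).
Proof.
move=> hp hl.
apply: (@polytime_ext _ _ _ _ (fun a => ~~ has (fun x => ~~ p a x) (l a))).
  by move=> a; rewrite -all_predC; apply: eq_all => x /=; rewrite negbK.
apply: polytime_negb; apply: polytime_has => //; exact: polytime_negb.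
Qed.

Lemma polytime_mem A (X : eqType) {eA : Enc A} {eX : Enc X}
    (x : A -> X) (l : A -> seq X) :
  injective (enc : X -> data) -> polytime x -> polytime l ->
  polytime (fun a => x a \in l a).
Proof.
move=> inj hx hl.
apply: (@polytime_ext _ _ _ _ (fun a => has (fun y => y == x a) (l a))).
  by move=> a; rewrite -has_pred1; apply: eq_has.
apply: polytime_has => //; apply: polytime_eq => //; first exact: polytime_snd.
by apply: (@polytime_comp _ _ _ _ _ _ x) => //; apply: polytime_fst.
Qed.

(** * Arithmetic in binary notation *)

Lemma half_ltn n : 0 < n -> n./2 < n.
Proof. by have := odd_double_half n; lia. Qed.

Lemma up_log_half n : 0 < n -> up_log 2 n.+1 = (up_log 2 n./2.+1).+1.
Proof.
move=> n0; apply/eqP; rewrite eqn_leq; apply/andP; split.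
  apply: up_log_min => //; rewrite expnS mul2n.
  have : n./2.+1 <= 2 ^ up_log 2 n./2.+1 by exact: up_logP.
  by have := odd_double_half n; lia.
have lt1 : 0 < up_log 2 n.+1 by rewrite up_log_gt0.
rewrite -(prednK lt1) ltnS; apply: up_log_min => //.
have : n.+1 <= 2 ^ up_log 2 n.+1 by exact: up_logP.
rewrite -{1}(prednK lt1) expnS mul2n.
by have := odd_double_half n; lia.
Qed.

Lemma bits_rec n : 0 < n -> bits n = odd n :: bits n./2.
Proof.
move=> n0; rewrite /bits up_log_half //= expn0 divn1; congr (_ :: _).
rewrite (iotaDl 1 0) -map_comp; apply: eq_map => i /=.
by rewrite add1n expnS divnMA divn2.
Qed.

Definition nat_of_bits : seq bool -> nat := foldr (fun (b : bool) n => b + n.*2) 0.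

Lemma bitsK : cancel bits nat_of_bits.
Proof.
move=> n; have [m] := ubnP n; elim: m n => // m IH [|n] // /ltnSE le.
rewrite bits_rec //; change ((odd n.+1 : nat) + (nat_of_bits (bits n.+1./2)).*2 = n.+1).
rewrite IH; first exact: odd_double_half.
by apply: leq_trans le; apply: half_ltn.
Qed.

Lemma enc_nat_inj : injective (enc : nat -> data).
Proof.
move=> m n e; apply: (can_inj bitsK); move: e; rewrite /enc /Enc_nat /enc_nat.
elim: (bits m) (bits n) => [|b s IH] [|c t] //= [eb /IH ->]; congr (_ :: _).
by case: b c eb => [] [].
Qed.

Fixpoint increment (carry : bool) (s : seq bool) : seq bool :=
  if s is b :: s' then (carry (+) b) :: increment (carry && b) s'
  else if carry then [:: true] else [::].

Lemma increment_false s : increment false s = s.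
Proof. by elim: s => //= b s ->. Qed.

Lemma bits_succ n : bits n.+1 = increment true (bits n).
Proof.
have [m] := ubnP n; elim: m n => // m IH [|n] // /ltnSE le.
rewrite [LHS]bits_rec // [in RHS]bits_rec // -[increment _ _]/(_ :: _) addTb.
congr (_ :: _); case e: (odd n.+1).
  have -> : n.+2./2 = (n.+1./2).+1 by have := odd_double_half n.+1; lia.
  by apply: IH; apply: leq_trans le; apply: half_ltn.
have -> : n.+2./2 = n.+1./2 by have := odd_double_half n.+1; lia.
exact: esym (increment_false _).
Qed.

Ltac pt_step := cbv beta; first [ assumption | match goal with
  | |- polytime (fun _ => ?b) => exact (polytime_const b)
  | |- polytime (fun a => a) => exact polytime_id
  | |- polytime id => exact polytime_id
  | |- polytime fst => exact polytime_fst
  | |- polytime snd => exact polytime_snd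
  | |- polytime (fun a => (@?f a, @?g a)) => apply (@polytime_pair _ _ _ _ _ _ f g)
  | |- polytime (fun a => (@?f a).1) => apply (@polytime_fst_of _ _ _ _ _ _ f)
  | |- polytime (fun a => (@?f a).2) => apply (@polytime_snd_of _ _ _ _ _ _ f)
  | |- polytime (fun a => @?f a :: @?g a) => apply (@polytime_cons _ _ _ _ f g)
  | |- polytime (fun a => @?f a && @?g a) => apply (@polytime_andb _ _ f g)
  | |- polytime (fun a => @?f a || @?g a) => apply (@polytime_orb _ _ f g)
  | |- polytime (fun a => ~~ @?f a) => apply (@polytime_negb _ _ f)
  | |- polytime (fun a => @?f a (+) @?g a) => apply (@polytime_addb _ _ f g)
  | |- polytime (fun a => rev (@?f a)) => apply (@polytime_rev _ _ _ _ f)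
  | |- polytime (fun a => @?f a ++ @?g a) => apply (@polytime_cat _ _ _ _ f g)
  | |- polytime (fun a => rcons (@?f a) (@?g a)) => apply (@polytime_rcons _ _ _ _ f g)
  | |- polytime (fun a => flatten (@?f a)) => apply (@polytime_flatten _ _ _ _ f)
  | |- polytime (fun a => map (@?f a) (@?l a)) =>
      apply (@polytime_map _ _ _ _ _ _ f l)
  | |- polytime (fun a => filter (@?f a) (@?l a)) =>
      apply (@polytime_filter _ _ _ _ f l)
  | |- polytime (fun a => has (@?f a) (@?l a)) => apply (@polytime_has _ _ _ _ f l)
  | |- polytime (fun a => all (@?f a) (@?l a)) => apply (@polytime_all _ _ _ _ f l)
  end | simple apply polytime_if ].

(** The carry starts at the least significant digit, which comes first in the list, so a left fold
    computes the successor. It collects the digits in reverse, and the last carry is put in front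
    before they are turned back. *)
Lemma polytime_succ A {eA : Enc A} (f : A -> nat) :
  polytime f -> polytime (fun a => (f a).+1).
Proof.
move=> hf; apply: (@polytime_comp _ _ _ _ _ _ succn f _ hf).
pose r (s : seq bool) := foldl (fun (z : bool * seq bool) b =>
  (z.1 && b, (z.1 (+) b) :: z.2)) (true, [::]) s.
have rE s : increment true s =
    rev (if (r s).1 then true :: (r s).2 else (r s).2).
  suff gen c t : rev t ++ increment c s = rev (let z := foldl (fun z b =>
      (z.1 && b, (z.1 (+) b) :: z.2)) (c, t) s in
      if z.1 then true :: z.2 else z.2) by exact: (gen true [::]).
  elim: s c t => [|b s IH] c t /=; last by rewrite -IH rev_cons cat_rcons.
  by case: c => /=; rewrite ?cats0 // rev_cons cats1.
have h : polytime (fun s : seq bool => increment true s).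
  apply: (polytime_ext (fun s => esym (rE s))).
  have hr : polytime r.
    apply: (@polytime_foldl_incr _ _ _ _ _ _ (fun _ z b =>
      (z.1 && b, (z.1 (+) b) :: z.2)) (fun _ => (true, [::])) id); repeat pt_step.
    exists 2 => a [c s] b; rewrite !dsize_pair dsize_cons /=.
    have : dsize (c && b) <= 3 by case: (c && b).
    have : dsize (c (+) b) <= 3 by case: (c (+) b).
    rewrite !expnS expn0; have : 0 < dsize b by exact: dsize_gt0.
    have : 0 < dsize a by exact: dsize_gt0.
    by nia.
  by repeat pt_step.
have hb : polytime bits.
  exact: (polytime_recode (fun n => erefl (enc n)) (@polytime_id nat _)).
by apply: polytime_recode (polytime_comp h hb) => n; rewrite -bits_succ.
Qed.

Lemma dsize_increment c (s : seq bool) :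
  dsize (increment c s) <= dsize s + (if c then 4 else 0).
Proof.
elim: s c => [|b s IH] c; first by case: c.
have -> : increment c (b :: s) = (c (+) b) :: increment (c && b) s by [].
rewrite !dsize_cons; move: (IH (c && b)) => {IH}.
by case: c b => [] [] /=; rewrite /(dsize true) /(dsize false) /=; lia.
Qed.

Lemma dsize_succ (n : nat) : dsize n.+1 <= dsize n + 4.
Proof.
rewrite /dsize [enc n.+1]/(enc (bits n.+1)) bits_succ.
exact: dsize_increment true (bits n).
Qed.

Fixpoint lookup A (d : A) (v : nat) (s : seq (nat * A)) : A :=
  if s is e :: s' then if e.1 == v then e.2 else lookup d v s' else d.

Lemma polytime_lookup A B {eA : Enc A} {eB : Enc B} (d : B)
    (v : A -> nat) (s : A -> seq (nat * B)) :
  polytime v -> polytime s -> polytime (fun a => lookup d (v a) (s a)).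
Proof.
(* The fold keeps the last match, hence the reversal: [lookup] returns the first one. *)
move=> hv hs; apply: (@polytime_ext _ _ _ _ (fun a =>
  foldl (fun r e => if e.1 == v a then e.2 else r) d (rev (s a)))).
  by move=> a; elim: (s a) => //= e t IH; rewrite rev_cons foldl_rcons IH.
apply: (@polytime_foldl_incr _ _ _ _ _ _
  (fun a r e => if e.1 == v a then e.2 else r) (fun _ => d)); repeat pt_step.
  apply: polytime_eq; [exact: enc_nat_inj| by repeat pt_step |].
  by apply: (polytime_comp hv); repeat pt_step.
exists 1 => a r [w b]; rewrite expn1 /= dsize_pair.
by case: ifP => _; lia.
Qed.

Lemma polytime_nth A B {eA : Enc A} {eB : Enc B} (d : B)
    (l : A -> seq B) (i : A -> nat) :
  polytime l -> polytime i -> polytime (fun a => nth d (l a) (i a)).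
Proof.
move=> hl hi; apply: (@polytime_ext _ _ _ _ (fun a =>
  (foldl (fun z x => (z.1.+1, if z.1 == i a then x else z.2)) (0, d) (l a)).2)).
  move=> a; suff gen n r : (foldl (fun z x =>
      (z.1.+1, if z.1 == i a then x else z.2)) (n, r) (l a)).2 =
      if n <= i a then nth r (l a) (i a - n) else r.
    by rewrite gen subn0.
  elim: (l a) n r => [|x s IH] n r /=; first by rewrite nth_nil; case: ifP.
  rewrite IH; case: (ltngtP n (i a)) => [lt|//|<-].
    by have -> : i a - n = (i a - n.+1).+1 by lia.
  by rewrite subnn.
apply: polytime_snd_of; apply: (@polytime_foldl_incr _ _ _ _ _ _
  (fun a z x => (z.1.+1, if z.1 == i a then x else z.2)) (fun _ => (0, d)));
  repeat pt_step.
- by apply: polytime_succ; repeat pt_step.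
- apply: polytime_eq; [exact: enc_nat_inj| by repeat pt_step |].
  by apply: (polytime_comp hi); repeat pt_step.
- exists 2 => a [n r] x; rewrite !dsize_pair.
  have := dsize_succ n; have ? : 0 < dsize a by exact: dsize_gt0.
  have ? : 0 < dsize x by exact: dsize_gt0.
  have : dsize (if n == i a then x else r) <= dsize x + dsize r by case: ifP; lia.
  rewrite !expnS expn0 /=; nia.
Qed.

(** * The construction *)

Definition visited (vis : seq (nat * nat)) (v : nat) : bool :=
  (v == 0) || (v \in [seq e.1 | e <- vis]).

Definition visit (vis : seq (nat * nat)) (e : nat * nat) : seq (nat * nat) :=
  if visited vis e.1 && ~~ visited vis e.2 then (e.2, e.1) :: vis
  else if visited vis e.2 && ~~ visited vis e.1 then e :: vis else vis.

(* The pairs (child, parent) of the tree rooted at 0, most recently visited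
   child first.  As many rounds over the links as there are nodes suffice. *)
Definition visit_order (T : seq (seq nat) * seq (nat * nat)) : seq (nat * nat) :=
  foldl visit [::] (flatten [seq T.2 | _ <- T.1]).

(* The event (v, (ws, ss)) is a choice at the node v with the variables q, q'
   and r: r passes the token to the node in ws, if any, and the terms r :: s
   for s in ss say when r has to be false. *)
Notation event := (nat * (seq nat * seq (seq (nat * bool))))%type.

Definition fits (B : seq nat) (C : seq literal) : bool :=
  all (fun l => l.1 \in B) C.

(** The leading event gives every node a copy of its bag, with or without clauses; its empty term
    makes [r] false, so the token stays. For a clause there is one term per literal, so that [r]
    makes each of them false. *)
Definition node_events (psi : CNF) (Bs : seq (seq nat)) (v : nat) : seq event :=
  (v, ([::], [:: [::]])) ::
  [seq (v, ([::], [seq [:: l] | l <- C])) | C <- psi & fits (nth [::] Bs v) C].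

(** In the order of visits a parent comes before its children. The choice that may pass the token to
    a child immediately precedes the events of that child, whose first copy is attached to the copy
    made by this choice. *)
Definition events (psi : CNF) (T : seq (seq nat) * seq (nat * nat)) : seq event :=
  node_events psi T.1 0 ++
  flatten [seq (e.2, ([:: e.1], [::])) :: node_events psi T.1 e.1
             | e <- rev (visit_order T)].

(* [qp] is the current variable of [ev.1] and the position of the bag that
   holds it, [mp] the first unused variable and the first unused position. *)
Definition gadget (Bs : seq (seq nat)) (qp : nat * nat) (mp : nat * nat)
    (ev : event) :=
  ([seq (w, (mp.1.+1, mp.2)) | w <- ev.2.1] ++ [:: (ev.1, mp)],
   ([:: [:: (qp.1, true); (mp.1, false); (mp.1.+1, false)];
        [:: (mp.1.+2, true)]] ++ [seq (mp.1.+1, true) :: t | t <- ev.2.2],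
    (nth [::] Bs ev.1 ++ [:: qp.1; mp.1; mp.1.+1; mp.1.+2],
     (mp.2, qp.2)))).

(* For each node its current variable and the position of the bag holding it
   (the first entry counts), the first unused variable and position, the terms,
   the bags and the links. *)
Definition state : Type :=
  seq (nat * (nat * nat)) *
  ((nat * nat) * (seq (seq (nat * bool)) * (seq (seq nat) * seq (nat * nat)))).

Definition cur (st : state) := st.1.
Definition fresh (st : state) := st.2.1.1.
Definition pos (st : state) := st.2.1.2.
Definition terms (st : state) := st.2.2.1.
Definition nbags (st : state) := st.2.2.2.1.
Definition nlinks (st : state) := st.2.2.2.2.

Definition step (Bs : seq (seq nat)) (st : state) (ev : event) : state :=
  let g := gadget Bs (lookup (0, 0) ev.1 (cur st)) (fresh st, pos st) ev in
  (g.1 ++ cur st, (((fresh st).+3, (pos st).+1),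
    (g.2.1 ++ terms st, (rcons (nbags st) g.2.2.1, g.2.2.2 :: nlinks st)))).

(* A number with more bits, all of them 1, than all variables of psi together. *)
Definition base (psi : CNF) : nat :=
  nat_of_bits (true :: [seq true | _ <- flatten [seq bits l.1 | l <- flatten psi]]).

(** [M] is the first current variable, at node 0; the negation of the term [[:: (M, false)]] makes
    it true. *)
Definition start (M : nat) : state :=
  ([:: (0, (M, 0))], ((M.+1, 1), ([:: [:: (M, false)]], ([:: [:: M]], [::])))).

Definition run (psi : CNF) (T : seq (seq nat) * seq (nat * nat)) : state :=
  foldl (step T.1) (start (base psi)) (events psi T).

(** In the negation, the added terms make the last current variable of each node false. Keys may
    recur in [cur st], but [lookup] sees only the latest entry. *)
Definition transform (i : CNF * (seq (seq nat) * seq (nat * nat))) :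
    DNF * (seq (seq nat) * seq (nat * nat)) :=
  let st := run i.1 i.2 in
  (terms st ++ [seq [:: ((lookup (0, 0) v (cur st)).1, true)]
                  | v <- [seq e.1 | e <- cur st]],
   (nbags st, nlinks st)).

(** * The construction takes polynomial time *)

Lemma polytime_order A {eA : Enc A} (T : A -> seq (seq nat) * seq (nat * nat)) :
  polytime T -> polytime (fun a => visit_order (T a)).
Proof.
move=> hT; apply: (@polytime_comp _ _ _ _ _ _ visit_order T _ hT).
apply: (@polytime_foldl_incr _ _ _ _ _ _ (fun _ => visit) (fun _ => [::])).
- have pv B (eB : Enc B) (s : B -> seq (nat * nat)) v : polytime s -> polytime v ->
      polytime (fun b => visited (s b) (v b)).
    move=> hs hv; apply: polytime_orb.
      by apply: polytime_eq; [exact: enc_nat_inj| |exact: polytime_const].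
    by apply: polytime_mem; [exact: enc_nat_inj| |repeat pt_step].
  by rewrite /visit; repeat (pt_step || apply: pv).
- by repeat pt_step.
- by repeat pt_step.
- exists 2 => a s [x y]; rewrite /visit /= !dsize_pair.
  by do 2?case: ifP => _; rewrite ?dsize_cons ?dsize_pair !expnS expn0; nia.
Qed.

Lemma polytime_node_events A {eA : Enc A} psi Bs (v : A -> nat) :
  polytime psi -> polytime Bs -> polytime v ->
  polytime (fun a => node_events (psi a) (Bs a) (v a)).
Proof.
move=> hp hB hv; rewrite /node_events /fits; repeat pt_step.
  by apply: (polytime_comp hv); repeat pt_step.
apply: polytime_mem; [exact: enc_nat_inj|by repeat pt_step|].
apply: polytime_nth.
  by apply: (polytime_comp hB); repeat pt_step.
by apply: (polytime_comp hv); repeat pt_step.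
Qed.

Lemma polytime_events :
  polytime (fun i : CNF * (seq (seq nat) * seq (nat * nat)) => events i.1 i.2).
Proof.
rewrite /events; repeat (pt_step || apply: polytime_node_events || apply: polytime_order).
Qed.

Lemma bits_ones n : bits (nat_of_bits (nseq n true)) = nseq n true.
Proof.
elim: n => // n IH; rewrite bits_rec //= odd_double /=; congr (_ :: _).
by rewrite uphalf_double.
Qed.

Lemma map_const A B (b : B) (s : seq A) : [seq b | _ <- s] = nseq (size s) b.
Proof. by elim: s => //= _ s ->. Qed.

(** A number whose bits are all 1 is encoded as a list of [true], so a bound on all variables is
    obtained by mapping over a list, without comparing or adding numbers. *)
Lemma polytime_base A {eA : Enc A} (psi : A -> CNF) :
  polytime psi -> polytime (fun a => base (psi a)).
Proof.
move=> hp; apply: (@polytime_recode _ _ _ _ _ _ (fun a =>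
  true :: [seq true | _ <- flatten [seq bits l.1 | l <- flatten (psi a)]])).
  by move=> a; rewrite /base map_const; exact: congr1 (esym (bits_ones _.+1)).
have hb : polytime bits.
  exact: (polytime_recode (fun n => erefl (enc n)) (@polytime_id nat _)).
repeat pt_step; apply: (polytime_comp hb); repeat pt_step.
Qed.

Lemma polytime_gadget :
  polytime (fun z : (seq (seq nat) * (nat * nat)) * ((nat * nat) * event) =>
    gadget z.1.1 z.1.2 z.2.1 z.2.2).
Proof.
by rewrite /gadget; repeat (pt_step || apply: polytime_succ || apply: polytime_nth).
Qed.

Lemma lookup_step Bs st ev v : lookup (0, 0) v (cur (step Bs st ev)) =
  if v \in ev.2.1 then ((fresh st).+1, pos st)
  else if v == ev.1 then (fresh st, pos st) else lookup (0, 0) v (cur st).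
Proof.
rewrite /cur /step /gadget /= -catA; elim: ev.2.1 => [|w ws IH] /=.
  by rewrite eq_sym.
by rewrite IH inE (eq_sym w); case: (v == w).
Qed.

Lemma polytime_run :
  polytime (fun i : CNF * (seq (seq nat) * seq (nat * nat)) => run i.1 i.2).
Proof.
have he := polytime_events.
have hbase : polytime (fun i : CNF * (seq (seq nat) * seq (nat * nat)) => base i.1).
  by apply: polytime_base; exact: polytime_fst.
have hstart : polytime (fun i : CNF * (seq (seq nat) * seq (nat * nat)) =>
    start (base i.1)).
  by rewrite /start; repeat (pt_step || apply: polytime_succ).
(* A step stores numbers that it reads from the state, so their sizes must be controlled. A
   successor adds at most 4 to the size of a number: 12 for the three fresh variables, 4 for the
   position. *)
apply: (@polytime_foldl_inv _ _ _ _ _ _ (fun i l1 st =>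
  [/\ dsize (fresh st) <= dsize (base i.1) + 4 + 12 * size l1,
      dsize (pos st) <= 10 + 4 * size l1 &
      forall v, dsize (lookup (0, 0) v (cur st)) <=
        dsize (base i.1) + 100 + 20 * size l1])
  (fun i => step i.2.1) (fun i => start (base i.1))) => //.
- pose q (z : (CNF * (seq (seq nat) * seq (nat * nat))) * state * event) :=
    ((z.1.1.2.1, lookup (0, 0) z.2.1 (cur z.1.2)), ((fresh z.1.2, pos z.1.2), z.2)).
  have hq : polytime q.
    by rewrite /q /cur /fresh /pos; repeat (pt_step || apply: polytime_lookup).
  have hg : polytime (fun z : (CNF * (seq (seq nat) * seq (nat * nat))) * state * event =>
      gadget z.1.1.2.1 (lookup (0, 0) z.2.1 (cur z.1.2)) (fresh z.1.2, pos z.1.2) z.2).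
    exact: polytime_comp polytime_gadget hq.
  by rewrite /step; repeat (pt_step || apply: polytime_succ
    || rewrite /cur /fresh /pos /terms /nbags /nlinks).
- move=> i; rewrite /start /fresh /pos /= !muln0 !addn0; split=> [|//|v].
    exact: dsize_succ.
  have s0 : dsize 0 = 1 by [].
  by case: ifP => _; rewrite dsize_pair s0 //; lia.
have [ke se] := polytime_size he; have [kb sb] := polytime_size hbase.
have [kg sg] := polytime_size polytime_gadget.
have [k hk] : pbounded (fun x => 50 +
    (x + 4 * (x.+2 ^ kb + 104 + 20 * x.+2 ^ ke) + 10).+2 ^ kg) by pbound.
exists k => a l1 ev l2 st el [hf hp hl]; split.
  split.
  - have -> : fresh (step a.2.1 st ev) = (fresh st).+3 by [].
    have := dsize_succ (fresh st); have := dsize_succ (fresh st).+1.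
    by have := dsize_succ (fresh st).+2; rewrite size_rcons; lia.
  - have -> : pos (step a.2.1 st ev) = (pos st).+1 by [].
    by have := dsize_succ (pos st); rewrite size_rcons; lia.
  - move=> v; rewrite lookup_step size_rcons.
    have := hl v; have := dsize_succ (fresh st).
    by do 2?[case: ifP => _]; rewrite ?dsize_pair; lia.
have sl1 : size l1 <= (dsize a).+2 ^ ke.
  apply: leq_trans (se a); apply: leq_trans (size_le_dsize _).
  by rewrite el size_cat leq_addr.
have := sg ((a.2.1, lookup (0, 0) ev.1 (cur st)), ((fresh st, pos st), ev)).
rewrite /=; set g := gadget _ _ _ _ => szg.
have szg' : dsize g <= (dsize a + dsize ev + 4 * ((dsize a + dsize ev).+2 ^ kb + 104
    + 20 * (dsize a + dsize ev).+2 ^ ke) + 10).+2 ^ kg.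
  apply: leq_trans szg _; case: (kg) => // kg0; rewrite leq_exp2r // 2!ltnS.
  have := hl ev.1; have := sb a.
  have : (dsize a).+2 ^ kb <= (dsize a + dsize ev).+2 ^ kb.
    by case: (kb) => // k0; rewrite leq_exp2r //; lia.
  have : (dsize a).+2 ^ ke <= (dsize a + dsize ev).+2 ^ ke.
    by case: (ke) => // k0; rewrite leq_exp2r //; lia.
  have : dsize a.2.1 <= dsize a by case: (a) => p [B L]; rewrite !dsize_pair /=; lia.
  by rewrite !dsize_pair; lia.
apply: leq_trans (_ : dsize st + (50 + dsize g) <= _); last first.
  by rewrite leq_add2l; apply: leq_trans (hk _); rewrite leq_add2l; exact: szg'.
have ds3 : dsize (fresh st).+3 <= dsize (fresh st) + 12.
  have := dsize_succ (fresh st); have := dsize_succ (fresh st).+1.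
  by have := dsize_succ (fresh st).+2; lia.
have ds1 := dsize_succ (pos st).
have E : step a.2.1 st ev = (g.1 ++ cur st, (((fresh st).+3, (pos st).+1),
    (g.2.1 ++ terms st, (rcons (nbags st) g.2.2.1, g.2.2.2 :: nlinks st)))) by [].
move: {szg szg'} g E => g ->; rewrite -cats1; move: ds3 ds1.
rewrite /fresh /pos /cur /terms /nbags /nlinks.
case: (st) => c [[m p] [t [b l]]] /=; case: g => g1 [g2 [g3 g4]] /=.
rewrite !(dsize_pair, dsize_cat, dsize_cons).
have -> : dsize ([::] : seq (seq nat)) = 1 by [].
by lia.
Qed.

Lemma polytime_transform : polytime transform.
Proof.
have hr := polytime_run; rewrite /transform /terms /nbags /nlinks /cur.
repeat (pt_step || apply: polytime_lookup || apply: polytime_order).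
by apply: (polytime_comp hr); repeat pt_step.
Qed.

(** * Restrictions and total valuations *)

Lemma mem_vars (F : seq (seq literal)) x :
  reflect (exists2 t, t \in F & exists2 l, l \in t & l.1 = x) (x \in vars F).
Proof.
rewrite mem_undup; apply: (iffP mapP) => [[l /flattenP [t tF lt] ->]|[t tF [l lt <-]]].
  by exists t => //; exists l.
by exists l => //; apply/flattenP; exists t.
Qed.

Definition falsified (f : nat -> bool) (t : seq literal) : bool :=
  has (fun l => f l.1 != l.2) t.

(** A total valuation extending [a] replaces both [a] and the assignment to what remains of the
    formula; the latter determines it up to values that no remaining literal sees. *)
Lemma satisfiable_negation_restrict (F : DNF) a : consistent a ->
  satisfiable (negation (restrict_dnf F a)) <->
  exists f : nat -> bool, (forall l, l \in a -> f l.1 = l.2) /\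
    forall t, t \in F -> falsified f t.
Proof.
move=> /allP consa; split=> [[b /andP [/allP consb _] sat]|[f [fa ft]]].
  pose f x := if (x, true) \in a then true else if (x, false) \in a then false
              else (x, true) \in b.
  have fa l : l \in a -> f l.1 = l.2.
    case: l => x [] la; rewrite /f /= la //.
    by have := consa _ la; rewrite /neg_lit /= => /negbTE ->.
  exists f; split => // t tF; apply/hasP.
  case: (boolP (has (fun l => neg_lit l \in a) t)) => [/hasP [l lt nla]|hn].
    by exists l => //; have := fa _ nla; rewrite /= => ->; case: (l.2).
  have mem : map neg_lit [seq l <- t | l \notin a] \in negation (restrict_dnf F a).
    by apply/map_f/map_f; rewrite mem_filter hn.
  case: (boolP (has (fun l => l \in b) (map neg_lit [seq l <- t | l \notin a])))
      => [|nh].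
    rewrite has_map => /hasP [l]; rewrite mem_filter => /andP [nla lt] /= nlb.
    exists l => //; have nnla : neg_lit l \notin a.
      by apply: contra hn => h; apply/hasP; exists l.
    move: nla nnla nlb (consb _ nlb); rewrite /f /neg_lit.
    case: l {lt} => x [] /= /negbTE -> /negbTE -> nlb; last by rewrite nlb.
    by move/negbTE=> ->.
  (* A clause without a literal of [b] would survive in a list that [sat] says is empty. *)
  have : [seq l <- map neg_lit [seq l <- t | l \notin a] | neg_lit l \notin b]
      \in restrict_cnf (negation (restrict_dnf F a)) b.
    by apply/map_f; rewrite mem_filter nh.
  by rewrite sat.
pose G := negation (restrict_dnf F a).
exists [seq (x, f x) | x <- vars G].
  apply/andP; split; apply/allP => l /mapP [x xG ->] //.
  by apply/mapP => -[y _ [<-]]; case: (f x).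
rewrite /satisfies /restrict_cnf; apply/eqP; rewrite -size_eq0 size_map size_filter.
rewrite -leqn0 leqNgt -has_count -all_predC; apply/allP => c cG /=; rewrite negbK.
have /mapP [t' t'F ec] := cG; have /mapP [t] := t'F.
rewrite mem_filter => /andP [/hasPn hn tF] et'.
have /hasP [l lt fl] := ft t tF.
have la : l \notin a by apply: contra fl => /fa ->.
have lc : neg_lit l \in c by rewrite ec et'; apply/map_f; rewrite mem_filter la.
apply/hasP; exists (neg_lit l) => //; apply/mapP; exists l.1.
  by apply/mem_vars; exists c => //; exists (neg_lit l).
by rewrite /neg_lit; move: fl; case: (f l.1) (l.2) => [] [].
Qed.

(** * Tree decompositions *)

(** Parents precede their children, so connectedness becomes local: each position of [x], except the
    first one, has [x] in its parent as well. In this form it survives the addition of a bag at the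
    end. *)
Definition rooted (Bs : seq (seq nat)) (L : seq (nat * nat)) : Prop :=
  exists par : nat -> nat,
  [/\ 0 < size Bs,
      forall e, e \in L -> 0 < e.1 < size Bs /\ par e.1 = e.2,
      forall i, 0 < i < size Bs -> (i, par i) \in L /\ par i < i
    & forall i x, 0 < i < size Bs -> x \in nth [::] Bs i ->
        x \in nth [::] Bs (par i) \/ forall j, j < i -> x \notin nth [::] Bs j].

Lemma rooted_rcons Bs L B p :
  rooted Bs L -> p < size Bs ->
  (forall x, x \in B ->
     x \in nth [::] Bs p \/ forall B', B' \in Bs -> x \notin B') ->
  rooted (rcons Bs B) ((size Bs, p) :: L).
Proof.
move=> [par [n0 hL hp hx]] lp hB.
exists (fun i => if i == size Bs then p else par i); rewrite size_rcons; split=> //.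
- move=> e; rewrite inE => /orP [/eqP -> /=|/hL [lt <-]]; first by rewrite eqxx n0 /=.
  by rewrite ltn_eqF; [split=> //; lia | lia].
- move=> i /andP [i0]; rewrite ltnS leq_eqVlt => /orP [/eqP ->|lt].
    by rewrite eqxx mem_head.
  by rewrite ltn_eqF // inE; have [] := hp i; rewrite ?i0 // => -> ->; rewrite orbT.
- move=> i x /andP [i0]; rewrite ltnS leq_eqVlt => /orP [/eqP ->|lt].
    rewrite eqxx !nth_rcons lp ltnn eqxx => /hB [|h]; [by left|right=> j lj].
    by rewrite nth_rcons lj; apply: h; exact: mem_nth.
  have [|_ lpi] := hp i; first by rewrite i0.
  rewrite ltn_eqF // !nth_rcons lt.
  rewrite (ltn_trans lpi lt) => xi.
  have hi : 0 < i < size Bs by rewrite i0.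
  have [|h] := hx i x hi xi; first by left.
  by right=> j lj; rewrite nth_rcons (ltn_trans lj lt); exact: h.
Qed.

Lemma adjacent_sym T : symmetric (@adjacent T).
Proof. by move=> i j; rewrite /adjacent orbC. Qed.

Lemma adjacent_at_sym T x : symmetric (@adjacent_at T x).
Proof. by move=> i j; rewrite /adjacent_at adjacent_sym [in X in _ && X]andbC. Qed.

(** Going up from any position leads to 0. On a cycle, the two neighbours of the largest position
    would both be its parent. *)
Lemma rooted_is_tree T : rooted (bags T) (links T) -> is_tree T.
Proof.
move=> [par [n0 hL hp _]]; have adjE (i j : 'I_(nb_nodes T)) :
    adjacent i j -> j <= i -> val j = par i /\ j < i.
  case/orP => /hL [] /= h pe le.
    by have [] := hp i h; rewrite pe.
  by have [] := hp j h; rewrite pe; lia.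
split=> //.
- apply/allP => e eL; have [h pe] := hL e eL; have [_] := hp _ h.
  rewrite pe /nb_nodes => lt; case/andP: h => _ h1.
  by rewrite h1 (ltn_trans lt h1) neq_ltn lt orbT.
- suff c0 i : connect (@adjacent T) i (Ordinal n0).
    move=> i j; apply: connect_trans (c0 i) _.
    by rewrite (sym_connect_sym (@adjacent_sym T)).
  have [m] := ubnP (val i); elim: m i => // m IH i /ltnSE le.
  have [i0|i0] := posnP (val i).
    by rewrite (_ : i = Ordinal n0) ?connect0 //; apply: val_inj.
  have hi : 0 < i < size (bags T) by rewrite i0 /=; exact: ltn_ord.
  have [pL lt] := hp i hi.
  have ltn : par i < nb_nodes T by apply: ltn_trans lt (ltn_ord i).
  apply: (@connect_trans _ _ (Ordinal ltn)).
    by apply: connect1; rewrite /adjacent pL.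
  by apply: IH => /=; exact: leq_trans le.
- move=> c /andP [cyc un]; rewrite leqNgt; apply/negP => sz.
  have [i0 i0c] : exists i, i \in c.
    by case: (c) sz => // i s _; exists i; rewrite mem_head.
  have [i ic imax] := arg_maxnP val i0c.
  have [k s er] := rot_to ic.
  have : uniq (rot k c) by rewrite rot_uniq.
  have : cycle (@adjacent T) (rot k c) by rewrite rot_cycle.
  have sz' : 2 < size (rot k c) by rewrite size_rot.
  have mx j : j \in rot k c -> j <= i by rewrite mem_rot => /imax.
  rewrite er in sz' mx *; case/lastP: s {er} sz' mx => // s z.
  case: s => // y s _ mx; rewrite /= rcons_path => /andP [iy /andP [_]].
  rewrite last_rcons adjacent_sym => iz.
  have [ey _] := adjE _ _ iy (mx y (mem_behead (s := i :: _) (mem_head _ _))).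
  have zin : z \in i :: y :: rcons s z by rewrite !inE mem_rcons mem_head !orbT.
  have [ez _] := adjE _ _ iz (mx z zin).
  have -> : y = z by apply: val_inj; rewrite ey ez.
  by rewrite mem_rcons mem_head /= andbF.
Qed.

(** Going up from any position of [x] stays among the positions of [x] until the first of them is
    reached. *)
Lemma rooted_connect T x (i j : 'I_(nb_nodes T)) :
  rooted (bags T) (links T) -> x \in bag T i -> x \in bag T j ->
  connect (@adjacent_at T x) i j.
Proof.
move=> [par [n0 _ hp hx]] xi xj.
have [k xk kmin] := arg_minnP (P := fun k : 'I_(nb_nodes T) => x \in bag T k) val xi.
suff ck (l : 'I_(nb_nodes T)) : x \in bag T l -> connect (@adjacent_at T x) l k.
  apply: connect_trans (ck i xi) _.
  by rewrite (sym_connect_sym (@adjacent_at_sym T x)); exact: ck.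
have [m] := ubnP (val l); elim: m l => // m IH l /ltnSE le xl.
have [-> //|ne] := eqVneq l k.
have lt : k < l by rewrite ltn_neqAle kmin // andbT eq_sym.
have hl : 0 < l < size (bags T).
  by rewrite (leq_ltn_trans (leq0n _) lt) /=; exact: (ltn_ord l).
have [pL ltp] := hp l hl.
have ltn : par l < nb_nodes T by apply: ltn_trans ltp (ltn_ord l).
have [xp|/(_ k lt)] := hx l x hl xl; last by move/negP; case.
apply: (@connect_trans _ _ (Ordinal ltn)).
  by apply: connect1; rewrite /adjacent_at /adjacent pL xl.
by apply: IH => //=; exact: leq_trans le.
Qed.

(** * Searching the input tree; the Helly property *)

Lemma visited_cons e vis v : visited (e :: vis) v = (v == e.1) || visited vis v.
Proof. by rewrite /visited /= inE orbCA. Qed.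

Fixpoint search (n : nat) (L : seq (nat * nat)) (vis : seq (nat * nat)) : Prop :=
  if vis is e :: vis' then
    [/\ e.1 < n /\ e.2 < n, visited vis' e.2, ~~ visited vis' e.1,
        (e \in L) || ((e.2, e.1) \in L) & search n L vis']
  else True.

Lemma search_order (T : tree_dec) : is_tree T ->
  search (nb_nodes T) (links T) (visit_order (bags T, links T)).
Proof.
move=> [_ /allP hL _ _]; rewrite /visit_order /=.
have : {subset flatten [seq links T | _ <- bags T] <= links T}.
  by move=> e /flattenP [s /mapP [B _ ->]].
have : search (nb_nodes T) (links T) [::] by [].
elim: (flatten _) [::] => //= e l IH vis hv sub; apply: IH; last first.
  by move=> e' le'; apply: sub; rewrite inE le' orbT.
have eL : e \in links T by apply: sub; rewrite mem_head.
have /and3P [l1 l2 _] := hL e eL.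
rewrite /visit; case: ifP => [/andP [h1 h2]|_]; last case: ifP => [/andP [h1 h2]|_] //.
  by split=> //=; rewrite -surjective_pairing eL orbT.
by split=> //=; rewrite eL.
Qed.

Lemma visited_foldl l vis v : visited vis v -> visited (foldl visit vis l) v.
Proof.
elim: l vis => //= e l IH vis h; apply: IH; rewrite /visit.
by do 2?[case: ifP => _]; rewrite ?visited_cons h ?orbT.
Qed.

Lemma visited_link l vis i j : ((i, j) \in l) || ((j, i) \in l) ->
  visited vis i -> visited (foldl visit vis l) j.
Proof.
elim: l vis => // e l IH vis h vi /=; have [[ee|ee]|hl] :
    (e = (i, j) \/ e = (j, i)) \/ ((i, j) \in l) || ((j, i) \in l).
- move: h; rewrite !inE => /orP [/orP [/eqP <-|h]|/orP [/eqP <-|h]];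
    by [left; left | left; right | right; rewrite h ?orbT].
- apply: visited_foldl; rewrite ee /visit /= vi /=.
  by case: (boolP (visited vis j)) => vj; rewrite ?andbF //= visited_cons eqxx.
- apply: visited_foldl; rewrite ee /visit /= vi /= andbF.
  by case: (boolP (visited vis j)) => vj; rewrite //= visited_cons eqxx.
- by apply: IH => //; apply: (@visited_foldl [:: e]).
Qed.

(** Each round over the links advances at least one edge along a path from node 0, and a path
    without repetition has fewer edges than the tree has nodes. *)
Lemma visited_order (T : tree_dec) v : is_tree T -> v < nb_nodes T ->
  visited (visit_order (bags T, links T)) v.
Proof.
move=> [n0 _ conn _] vn; rewrite /visit_order /=.
have {conn} := conn (Ordinal n0) (Ordinal vn).
case/connectP => p0 pth0 ev; have -> : v = val (last (Ordinal n0) p0) by rewrite -ev.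
case/shortenP: pth0 {ev} => p pth un _.
have : size p <= size (bags T).
  have := max_card (mem (Ordinal n0 :: p)).
  by rewrite card_ord (card_uniqP un) => /ltnW.
have : visited [::] (val (Ordinal n0)) by [].
elim: (bags T) [::] (Ordinal n0) p pth {un} => [|B Bs IH] vis i [|j p] //=.
- by move=> _ h _; rewrite visited_foldl.
- case/andP=> ij pth vi sz; rewrite foldl_cat; apply: IH => //.
  exact: visited_link ij vi.
Qed.

(** The tree with [w] deleted, whose components are the branches at [w]. *)
Definition adjacent_off (T : tree_dec) (w : 'I_(nb_nodes T)) : rel 'I_(nb_nodes T) :=
  fun i j => [&& adjacent i j, i != w & j != w].

Lemma adjacent_off_sym T (w : 'I_(nb_nodes T)) : symmetric (adjacent_off w).
Proof. by move=> i j; rewrite /adjacent_off adjacent_sym [in X in _ && X]andbC. Qed.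

Lemma tree_neighbours T (w y z : 'I_(nb_nodes T)) : is_tree T ->
  adjacent w y -> adjacent w z -> y != w -> connect (adjacent_off w) y z -> y = z.
Proof.
move=> [_ _ _ acyc] wy wz yw /connectP [p0 pth0 ez].
rewrite ez in wz *; case/shortenP: pth0 wz {ez} => q pth un _ wz.
have pw : path (@adjacent T) y q by apply: sub_path pth => i j /and3P [].
have qw : w \notin y :: q.
  rewrite inE negb_or eq_sym yw /=; elim: q y pth {wz pw un yw wy} => //= j q IH y.
  by case/andP => /and3P [_ _ jw] /IH; rewrite inE negb_or eq_sym jw.
have := acyc (w :: y :: q); rewrite /ucycle /= rcons_path pw wy /=.
rewrite adjacent_sym wz; move: un qw => /= -> ->.
by case: (q) => // j s; rewrite /= !ltnS ltn0; move/(_ isT).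
Qed.

(** From a visited node the parents lead to node 0 through visited nodes, hence around [w]. *)
Lemma search_connect T vis (w u v : 'I_(nb_nodes T)) :
  search (nb_nodes T) (links T) vis -> ~~ visited vis w ->
  visited vis u -> visited vis v -> connect (adjacent_off w) u v.
Proof.
move=> hs hw hu hv; have n0 : 0 < nb_nodes T by exact: leq_ltn_trans (ltn_ord w).
suff c0 i : visited vis (val i) -> connect (adjacent_off w) i (Ordinal n0).
  apply: connect_trans (c0 u hu) _.
  by rewrite (sym_connect_sym (@adjacent_off_sym T w)); exact: c0.
elim: vis hs hw i {u v hu hv} => [|e vis IH] /=.
  rewrite /visited /= => _ _ i; rewrite orbF => /eqP i0.
  by rewrite (_ : i = Ordinal n0) ?connect0 //; apply: val_inj.
case=> -[e1 e2] v2 v1 eL hs; rewrite visited_cons negb_or => /andP [we wv] i.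
rewrite visited_cons => /orP [/eqP ie|]; last exact: IH.
apply: (@connect_trans _ _ (Ordinal e2)); last exact: IH.
apply: connect1; rewrite /adjacent_off /adjacent /= ie -surjective_pairing eL /=.
rewrite -!val_eqE /= ie eq_sym we /=; apply: contraNneq wv => <-.
by [].
Qed.

(** A simple path from [e.1] to [u] through bags containing [x] leaves [e.1] by the neighbour on the
    branch of [u]. As all visited nodes lie on one branch, this neighbour is the parent [e.2]. *)
Lemma search_bag T vis e x u : is_tree T ->
  (forall x (i j : 'I_(nb_nodes T)), x \in bag T i -> x \in bag T j ->
     connect (@adjacent_at T x) i j) ->
  search (nb_nodes T) (links T) (e :: vis) ->
  x \in bag T e.1 -> visited vis u -> x \in bag T u -> x \in bag T e.2.
Proof.
move=> tree conn [[e1 e2] v2 v1 eL hs] xw vu xu.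
have un : u < nb_nodes T.
  by rewrite ltnNge; apply/negP => h; rewrite /bag nth_default in xu.
have /connectP [p0 pth0 eu] := conn x (Ordinal e1) (Ordinal un) xw xu.
have ew : adjacent (Ordinal e1) (Ordinal e2).
  by rewrite /adjacent /= -surjective_pairing eL.
case/shortenP: pth0 eu => -[|y q] pth uq _ eu.
  by move/(congr1 val): eu => /= eu; rewrite eu (negbTE v1) in vu.
move: pth => /= /andP [/and3P [wy _ xy] pth].
move: uq => /= /andP [wq _].
have yw : y != Ordinal e1.
  by apply: contraNneq wq => ->; rewrite mem_head.
suff ey : y = Ordinal e2 by move: xy; rewrite ey.
apply: (tree_neighbours tree wy ew yw).
apply: (@connect_trans _ _ (Ordinal un)); last first.
  exact: (@search_connect _ vis (Ordinal e1)).
apply/connectP; exists q => //.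
elim: q y pth wq {wy eu xy yw} => //= j q IH y /andP [/and3P [yj _ _] pth].
rewrite !inE !negb_or => /and3P [wy wj wq].
by rewrite /adjacent_off yj eq_sym wy eq_sym wj IH // inE negb_or wj.
Qed.

Lemma search_clique T vis (C : seq nat) : is_tree T ->
  (forall x (i j : 'I_(nb_nodes T)), x \in bag T i -> x \in bag T j ->
     connect (@adjacent_at T x) i j) ->
  search (nb_nodes T) (links T) vis ->
  (forall x y, x \in C -> y \in C ->
     exists2 u, visited vis u & (x \in bag T u) && (y \in bag T u)) ->
  exists2 u, visited vis u & {subset C <= bag T u}.
Proof.
move=> tree conn; elim: vis => [|e vis IH] hs hC.
  exists 0 => // x xC; have [u] := hC x x xC xC.
  by rewrite /visited orbF => /eqP -> /andP [].
have [_ v2 v1 _ hs'] := hs.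
pose seen x := has (fun u => x \in bag T u) (0 :: [seq e.1 | e <- vis]).
have seenP x : reflect (exists2 u, visited vis u & x \in bag T u) (seen x).
  by apply: (iffP hasP) => -[u vu xu]; exists u.
case: (boolP (all seen C)) => [/allP allC|/allPn [x xC /seenP nx]].
  have [|u vu sub] := IH hs'; last by exists u; rewrite ?visited_cons ?vu ?orbT.
  move=> x y xC yC; have [u] := hC x y xC yC; rewrite visited_cons.
  case/orP => [/eqP ->|vu] /andP [xu yu]; last by exists u; rewrite ?xu.
  exists e.2 => //; apply/andP; split.
    by have /seenP [u' vu' xu'] := allC x xC; exact: search_bag vu' xu'.
  by have /seenP [u' vu' yu'] := allC y yC; exact: search_bag vu' yu'.
exists e.1; first by rewrite visited_cons eqxx.
move=> y yC; have [u] := hC x y xC yC; rewrite visited_cons.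
case/orP => [/eqP -> /andP [] //|vu /andP [xu _]].
by case: nx; exists u.
Qed.

(** * The sequence of events is compatible with the tree *)

Definition owner (Bs : seq (seq nat)) (K : seq (nat * nat)) (v : nat) : seq nat :=
  nth [::] Bs (lookup (size Bs) v K).

(* [A] lists the nodes that already have a copy in the new tree; the copy to
   which the next copy of [v] is to be attached is a copy of [lookup _ v K],
   and contains no variable of the formula if that is not a node. *)
Fixpoint valid_events (Bs : seq (seq nat)) (A : seq nat) (K : seq (nat * nat))
    (evs : seq event) : Prop :=
  if evs is ev :: evs' then
    [/\ ev.1 \in unzip1 K,
        ev.2.1 = [::] \/ exists2 w, w \notin unzip1 K & ev.2 = ([:: w], [::]),
        forall t, t \in ev.2.2 ->
          t = [::] \/ exists2 l, l.1 \in nth [::] Bs ev.1 & t = [:: l],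
        forall x, x \in nth [::] Bs ev.1 -> x \in owner Bs K ev.1 \/
          forall u, u \in A -> x \notin nth [::] Bs u
      & valid_events Bs (ev.1 :: A)
          ([seq (w, ev.1) | w <- ev.2.1] ++ (ev.1, ev.1) :: K) evs']
  else True.

(** The situation once the events of a visited node are complete: exactly the visited nodes have
    copies, and each is to be continued from a copy of itself. *)
Definition tracks vis (A : seq nat) (K : seq (nat * nat)) (n : nat) : Prop :=
  [/\ A =i visited vis, unzip1 K =i visited vis &
     forall v, visited vis v -> lookup n v K = v].

Lemma valid_node_events psi Bs vis v A K rest : visited vis v ->
  v \in unzip1 K ->
  (forall x, x \in nth [::] Bs v -> x \in owner Bs K v \/
     forall u, u \in A -> x \notin nth [::] Bs u) ->
  tracks vis (v :: A) ((v, v) :: K) (size Bs) ->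
  (forall A' K', tracks vis A' K' (size Bs) -> valid_events Bs A' K' rest) ->
  valid_events Bs A K (node_events psi Bs v ++ rest).
Proof.
move=> vv vK fresh_v tr hrest; rewrite /node_events cat_cons /=; split=> //.
- by left.
- by move=> t; rewrite inE => /eqP ->; left.
move: {A K vK fresh_v} (v :: A) ((v, v) :: K) tr; elim: psi => [|C psi IH] A K tr /=.
  exact: hrest.
case: ifP => [fC|_] /=; last exact: IH.
have [hA hK hl] := tr; split.
- by rewrite hK.
- by left.
- move=> t /mapP [l lC ->]; right; exists l => //.
  by move/allP: fC; apply.
- by move=> x xv; left; rewrite /owner hl.
- apply: IH; split=> [u|u|u vu] /=.
  + by rewrite inE hA; case: eqP => // ->.
  + by rewrite inE hK; case: eqP => // ->.
  + by case: eqP => [<-//|_]; exact: hl.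
Qed.

Lemma valid_events_tree psi (T : tree_dec) : is_tree T ->
  (forall x (i j : 'I_(nb_nodes T)), x \in bag T i -> x \in bag T j ->
     connect (@adjacent_at T x) i j) ->
  valid_events (bags T) [::] [:: (0, nb_nodes T)] (events psi (bags T, links T)).
Proof.
move=> tree conn; rewrite /events /=.
have := search_order tree.
(* In [catrev es vis], the entries of [vis] have been treated and those of [es] are to come; this is
   what the induction on [es] needs. *)
set vis := visit_order _; have e : vis = catrev (rev vis) [::].
  by rewrite catrevE cats0 revK.
rewrite {1}e; move: {e vis} (rev vis) => es hs.
(* [nb_nodes T] is no node: the first copy of node 0 is attached to a bag without variables of the
   formula. *)
have tr0 : tracks [::] [:: 0] [:: (0, 0); (0, nb_nodes T)] (nb_nodes T).
  split=> v; rewrite /visited /=.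
  - by rewrite !inE; case: (v == 0).
  - by rewrite !inE; case: (v == 0).
  - by rewrite in_nil orbF => /eqP ->.
apply: valid_node_events tr0 _ => //; first by move=> x _; right.
elim: es [::] hs => //= e es IH vis hs A K tr.
have hs' : search (nb_nodes T) (links T) (e :: vis).
  elim: (es) (e :: vis) hs => //= e' es' IH' vis' /IH' /=; by case.
have [_ v2 v1 _ _] := hs'; have [hA hK hl] := tr.
have sB : size (bags T) = nb_nodes T by [].
split.
- by rewrite hK.
- by right; exists e.1 => //; rewrite hK.
- by [].
- by move=> x xv; left; rewrite /owner sB hl.
have ne : e.1 == e.2 = false by apply: contraNF v1 => /eqP ->.
pose rest := flatten [seq (e.2, ([:: e.1], [::])) :: node_events psi (bags T) e.1
  | e <- es].
suff : valid_events (bags T) (e.2 :: A) [:: (e.1, e.2), (e.2, e.2) & K]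
  (node_events psi (bags T) e.1 ++ rest) by [].
apply: (@valid_node_events _ _ (e :: vis)); rewrite ?inE ?eqxx //.
- by rewrite visited_cons eqxx.
(* The first copy of a child is attached to a copy of its parent. By [search_bag], a variable
   missing there is in no visited bag, so it makes its first appearance. *)
- move=> x xw; rewrite /owner /= eqxx.
  case: (boolP (x \in nth [::] (bags T) e.2)) => h; [by left|right=> u].
  rewrite inE => /orP [/eqP -> //|]; rewrite hA => vu; apply: contra h => xu.
  exact: (search_bag tree conn hs' xw vu xu).
- split=> u.
  + rewrite [RHS]visited_cons !inE hA -[_ \in visited _]/(visited _ _).
    by case: (u == e.1) => //=; case: eqP => // ->.
  + rewrite [RHS]visited_cons /= !inE hK -[_ \in visited _]/(visited _ _).
    by rewrite orbA orbb; case: (u == e.1) => //=; case: eqP => // ->.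
  + rewrite visited_cons /= (eq_sym e.1 u); have [-> //|_ /= vu] := eqVneq u e.1.
    by case: eqP => // _; exact: hl.
- by move=> A' K' tr'; exact: (IH (e :: vis) hs A' K' tr').
Qed.

(** * Correctness *)

(** [wf_cur] says that the bag to attach to holds the variables that the next copy shares with
    earlier bags. [wf_inj] lets the value of one current variable change without affecting another.
    [wf_size] and [wf_copy] are the two inequalities for the exact width, and [wf_vars] is there
    because bags may contain only variables of the formula. *)
Record wf_state (Bs : seq (seq nat)) (M : nat) (A : seq nat) (K : seq (nat * nat))
    (st : state) : Prop := WfState {
  wf_keys : unzip1 (cur st) = unzip1 K;
  wf_pos : pos st = size (nbags st);
  wf_fresh : M < fresh st;
  wf_cur : forall v, v \in unzip1 K ->
    let qp := lookup (0, 0) v (cur st) in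
    [/\ qp.2 < size (nbags st), qp.1 \in nth [::] (nbags st) qp.2,
        M <= qp.1 < fresh st & {subset owner Bs K v <= nth [::] (nbags st) qp.2}];
  wf_inj : forall u v, u \in unzip1 K -> v \in unzip1 K ->
    (lookup (0, 0) u (cur st)).1 = (lookup (0, 0) v (cur st)).1 -> u = v;
  wf_rooted : rooted (nbags st) (nlinks st);
  wf_bags : forall B x, B \in nbags st -> x \in B ->
    M <= x < fresh st \/ exists2 u, u \in A & x \in nth [::] Bs u;
  wf_size : forall B, B \in nbags st -> size (undup B) = 1 \/
    exists2 u, u \in A & size (undup B) = size (undup (nth [::] Bs u)) + 4;
  wf_copy : forall u, u \in A -> exists2 B, B \in nbags st &
    size (undup B) = size (undup (nth [::] Bs u)) + 4;
  wf_terms : forall t, t \in terms st ->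
    consistent t /\ exists2 B, B \in nbags st & forall l, l \in t -> l.1 \in B;
  wf_vars : forall B x, B \in nbags st -> x \in B -> M <= x -> x \in vars (terms st)
}.

Lemma wf_start Bs M : wf_state Bs M [::] [:: (0, size Bs)] (start M).
Proof.
split=> //.
- move=> v; rewrite inE => /eqP -> /=; rewrite /owner /= nth_default //.
  by split; rewrite //= ?inE ?eqxx // leqnn /fresh /=.
- by move=> u v; rewrite !inE => /eqP -> /eqP ->.
- by exists (fun => 0); split=> // i; rewrite /nbags /=; case: i.
- move=> B x; rewrite inE => /eqP ->; rewrite inE => /eqP ->; left.
  by rewrite leqnn /fresh /=.
- by move=> B; rewrite inE => /eqP ->; left.
- move=> t; rewrite inE => /eqP ->; split.
    by rewrite /consistent /= inE /neg_lit /= xpair_eqE andbF.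
  by exists [:: M]; rewrite ?mem_head // => l; rewrite inE => /eqP ->; rewrite mem_head.
- by move=> B x; rewrite inE => /eqP ->; rewrite inE => /eqP -> _ /=.
Qed.

Lemma vars_subset (F G : seq (seq literal)) x :
  {subset F <= G} -> x \in vars F -> x \in vars G.
Proof.
by move=> sub /mem_vars [t tF h]; apply/mem_vars; exists t => //; exact: sub.
Qed.

Definition new_terms (st : state) (ev : event) : seq (seq (nat * bool)) :=
  [:: ((lookup (0, 0) ev.1 (cur st)).1, true); (fresh st, false); ((fresh st).+1, false)]
  :: [:: ((fresh st).+2, true)] :: [seq ((fresh st).+1, true) :: s | s <- ev.2.2].

Lemma terms_step Bs st ev : terms (step Bs st ev) = new_terms st ev ++ terms st.
Proof. by []. Qed.

Lemma terms_foldl Bs st evs :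
  {subset terms st <= terms (foldl (step Bs) st evs)}.
Proof.
elim: evs st => [|ev evs IH] st t h //=; apply: IH.
by rewrite terms_step mem_cat h orbT.
Qed.

Lemma mem_new_terms st ev t : t \in new_terms st ev ->
  [\/ t = [:: ((lookup (0, 0) ev.1 (cur st)).1, true); (fresh st, false);
              ((fresh st).+1, false)],
      t = [:: ((fresh st).+2, true)]
    | exists2 s, s \in ev.2.2 & t = ((fresh st).+1, true) :: s].
Proof.
rewrite !inE => /or3P [/eqP ->|/eqP ->|/mapP [s sS ->]].
- by constructor 1.
- by constructor 2.
- by constructor 3; exists s.
Qed.

Lemma lookup_owner v (ws : seq nat) K n u :
  lookup n u ([seq (w, v) | w <- ws] ++ (v, v) :: K) =
  if (u \in ws) || (u == v) then v else lookup n u K.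
Proof.
elim: ws => [|w ws IH] /=; first by rewrite (eq_sym v).
by rewrite IH inE (eq_sym w); case: (u == w).
Qed.

Lemma undup_cat_fresh (b s : seq nat) : uniq s -> (forall x, x \in b -> x \notin s) ->
  size (undup (b ++ s)) = size (undup b) + size s.
Proof.
move=> us bs; rewrite undup_cat size_cat (undup_id us) (eq_in_filter (a2 := predT)).
  by rewrite filter_predT.
by move=> x; rewrite mem_undup => /bs.
Qed.

Lemma uniq_consistent (t : seq literal) : uniq [seq l.1 | l <- t] -> consistent t.
Proof.
elim: t => // l t IH /= /andP [/mapP lt /IH /allP ct]; apply/andP; split.
  rewrite inE negb_or; apply/andP; split.
    by apply/eqP => /(congr1 snd); rewrite /neg_lit /=; case: (l.2).
  by apply/negP => h; apply: lt; exists (neg_lit l).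
apply/allP => l' l't; rewrite inE negb_or ct // andbT.
by apply/eqP => e; apply: lt; exists l'; rewrite // -e.
Qed.

Lemma wf_step Bs M A K st ev evs :
  (forall u x, x \in nth [::] Bs u -> x < M) ->
  valid_events Bs A K (ev :: evs) -> wf_state Bs M A K st ->
  wf_state Bs M (ev.1 :: A) ([seq (w, ev.1) | w <- ev.2.1] ++ (ev.1, ev.1) :: K)
    (step Bs st ev).
Proof.
move=> ltM [vK hws htl hrd _].
move=> [wkeys wpos wfr wcur winj wroot wbags wsize wcopy wterms wvars].
have [/= lp qin /andP [Mq qf] osub] := wcur _ vK.
move: (erefl (lookup (0, 0) ev.1 (cur st))) lp qin Mq qf osub.
set qp := {2}(lookup _ _ _) => eqp; rewrite eqp => lp qin Mq qf osub.
set v := ev.1 in vK hws htl hrd eqp osub *; set m := fresh st in wfr wbags qf *.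
pose B' := nth [::] Bs v ++ [:: qp.1; m; m.+1; m.+2].
have ebags : nbags (step Bs st ev) = rcons (nbags st) B'.
  by rewrite /step /nbags /= -/v eqp.
have elinks : nlinks (step Bs st ev) = (size (nbags st), qp.2) :: nlinks st.
  by rewrite /step /nlinks /= -/v eqp wpos.
have efresh : fresh (step Bs st ev) = m.+3 by [].
have mB x : x \in B' = [|| x \in nth [::] Bs v, x == qp.1, x == m, x == m.+1 | x == m.+2].
  by rewrite mem_cat !inE.
have memK u : u \in unzip1 ([seq (w, v) | w <- ev.2.1] ++ (v, v) :: K) ->
    [|| u \in ev.2.1, u == v | u \in unzip1 K].
  rewrite /unzip1 map_cat mem_cat -map_comp (eq_map (g := id)) // map_id.
  by rewrite /= inE.
have wsK w : w \in ev.2.1 -> w \notin unzip1 K.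
  by case: hws => [-> //|[w' w'K ->]]; rewrite inE => /eqP ->.
have bag_old B x : B \in nbags st -> x \in B -> x < m.
  move=> BB xB; case: (wbags B x BB xB) => [/andP [] //|[u _ /ltM lt]].
  exact: ltn_trans lt wfr.
have nthB p : p < size (nbags st) ->
    nth [::] (nbags (step Bs st ev)) p = nth [::] (nbags st) p.
  by move=> h; rewrite ebags nth_rcons h.
have nthB' : nth [::] (nbags (step Bs st ev)) (size (nbags st)) = B'.
  by rewrite ebags nth_rcons ltnn eqxx.
have memB' : B' \in nbags (step Bs st ev) by rewrite ebags mem_rcons mem_head.
have oldB B : B \in nbags st -> B \in nbags (step Bs st ev).
  by move=> h; rewrite ebags mem_rcons inE h orbT.
split.
- rewrite /cur /step /= -/(cur st) /unzip1 !map_cat /= -!map_comp -/(unzip1 _) wkeys.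
  by rewrite -catA.
- by rewrite ebags size_rcons /pos /step /= -/(pos st) wpos.
- by rewrite efresh; lia.
- move=> u /memK uK; rewrite lookup_step -/m -/v /owner lookup_owner.
  case: (boolP (u \in ev.2.1)) uK => [uw _|nuw] /=.
    rewrite wpos nthB' efresh ebags size_rcons; split=> //.
    + by rewrite mB eqxx !orbT.
    + by lia.
    + by move=> x xv; rewrite mB xv.
  case: (eqVneq u v) => [_ _|nuv] /=.
    rewrite wpos nthB' efresh ebags size_rcons; split=> //.
    + by rewrite mB eqxx !orbT.
    + by lia.
    + by move=> x xv; rewrite mB xv.
  move=> uK; have [/= l1 l2 l3 l4] := wcur u uK.
  rewrite nthB // ebags size_rcons efresh; split=> //.
  + by rewrite ltnS ltnW.
  + by lia.
(* The only new current variables are [m] and [m.+1], above all the old ones. *)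
- have old u : u \notin ev.2.1 -> u != v -> u \in unzip1 K ->
      (lookup (0, 0) u (cur st)).1 < m.
    by move=> _ _ uK; have [_ _ /andP []] := wcur u uK.
  have ws1 a b : a \in ev.2.1 -> b \in ev.2.1 -> a = b.
    by case: hws => [->|[w _ ->]] //; rewrite !inE => /eqP -> /eqP ->.
  move=> a b /memK aK /memK bK; rewrite !lookup_step -/m -/v.
  case: (boolP (a \in ev.2.1)) aK => [aw _|naw] /=;
    case: (boolP (b \in ev.2.1)) bK => [bw _|nbw] /=; first by move=> _; exact: ws1.
  + case: (eqVneq b v) => [_ _ /=|nbv bK]; first by lia.
    by move=> e; have := old b nbw nbv bK; lia.
  + case: (eqVneq a v) => [_ _ /=|nav aK]; first by lia.
    by move=> e; have := old a naw nav aK; lia.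
  + case: (eqVneq b v) => [-> _|nbv bK]; case: (eqVneq a v) => [-> _|nav aK] /=;
      first by [].
    * by move=> e; have := old a naw nav aK; lia.
    * by move=> e; have := old b nbw nbv bK; lia.
    * exact: winj.
(* A variable of the bag of [v] is in the owner, whose variables the parent bag contains, or is seen
   here first; [qp.1] is in the parent bag; the other three are fresh. *)
- rewrite ebags elinks; apply: rooted_rcons => // x; rewrite mB.
  case/orP => [xv|/orP [/eqP ->|h]].
  + case: (hrd x xv) => [h|h]; first by left; exact: osub.
    right=> B BB; apply/negP => xB; case: (wbags B x BB xB) => [/andP [h1 _]|[u uA xu]].
      by have := ltM _ _ xv; lia.
    by have := h u uA; rewrite xu.
  + by left.
  + right=> B BB; apply/negP => xB; have := bag_old B x BB xB.
    by case/or3P: h => /eqP ->; lia.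
- move=> B x; rewrite ebags mem_rcons inE efresh => /orP [/eqP -> |BB xB].
    rewrite mB => /orP [xv|h]; first by right; exists v; rewrite ?mem_head.
    by left; case/or4P: h => /eqP ->; lia.
  case: (wbags B x BB xB) => [h|[u uA xu]]; first by left; lia.
  by right; exists u; rewrite // inE uA orbT.
- have szB : size (undup B') = size (undup (nth [::] Bs v)) + 4.
    apply: undup_cat_fresh => [|x /ltM lt]; rewrite /= !inE; lia.
  move=> B; rewrite ebags mem_rcons inE => /orP [/eqP ->|BB].
    by right; exists v; rewrite ?mem_head.
  by case: (wsize B BB) => [|[u uA e]]; [left|right; exists u; rewrite // inE uA orbT].
- have szB : size (undup B') = size (undup (nth [::] Bs v)) + 4.
    apply: undup_cat_fresh => [|x /ltM lt]; rewrite /= !inE; lia.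
  move=> u; rewrite inE => /orP [/eqP ->|uA]; first by exists B'.
  by have [B BB e] := wcopy u uA; exists B => //; exact: oldB.
- move=> t; rewrite terms_step mem_cat => /orP [/mem_new_terms|tt]; last first.
  + have [c [B BB h]] := wterms t tt; split=> //; exists B => //; exact: oldB.
  rewrite -/v -/m eqp => -[->|->|[s sS ->]].
  + split; first by apply: uniq_consistent; rewrite /= !inE; lia.
    exists B' => // l; rewrite !inE => /or3P [] /eqP -> /=; by rewrite mB eqxx !orbT.
  + split; first exact: uniq_consistent.
    by exists B' => // l; rewrite !inE => /eqP -> /=; rewrite mB eqxx !orbT.
  + case: (htl s sS) => [->|[l lv ->]].
      split; first exact: uniq_consistent.
      by exists B' => // l; rewrite !inE => /eqP -> /=; rewrite mB eqxx !orbT.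
    have lt := ltM _ _ lv; split.
      apply: uniq_consistent; rewrite /= inE andbT neq_ltn; apply/orP; right.
      by apply: leq_trans lt _; apply: ltnW; exact: leqW.
    exists B' => // l'; rewrite !inE => /orP [] /eqP -> /=; rewrite mB ?lv //.
    by rewrite eqxx !orbT.
- have sub : {subset terms st <= terms (step Bs st ev)} 
    by move=> t h; rewrite terms_step mem_cat h orbT.
  move=> B x; rewrite ebags mem_rcons inE => /orP [/eqP ->|BB xB Mx].
    rewrite mB => /orP [/ltM lt|h] Mx; first by lia.
    apply/mem_vars; case/or4P: h => /eqP ->.
    + exists [:: (qp.1, true); (m, false); (m.+1, false)].
        by rewrite terms_step /new_terms -/v -/m eqp mem_head.
      by exists (qp.1, true); rewrite ?mem_head.
    + exists [:: (qp.1, true); (m, false); (m.+1, false)].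
        by rewrite terms_step /new_terms -/v -/m eqp mem_head.
      by exists (m, false); rewrite ?inE ?eqxx ?orbT.
    + exists [:: (qp.1, true); (m, false); (m.+1, false)].
        by rewrite terms_step /new_terms -/v -/m eqp mem_head.
      by exists (m.+1, false); rewrite ?inE ?eqxx ?orbT.
    + exists [:: (m.+2, true)].
        by rewrite terms_step /new_terms -/v -/m eqp !inE eqxx orbT.
      by exists (m.+2, true); rewrite ?mem_head.
  exact: vars_subset sub (wvars B x BB xB Mx).
Qed.

Lemma keys_step Bs st ev :
  unzip1 (cur (step Bs st ev)) = ev.2.1 ++ ev.1 :: unzip1 (cur st).
Proof.
rewrite /cur /step /gadget /= /unzip1 !map_cat -map_comp (eq_map (g := id)) //.
by rewrite map_id -catA.
Qed.

Lemma wf_run Bs M A K st evs :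
  (forall u x, x \in nth [::] Bs u -> x < M) ->
  valid_events Bs A K evs -> wf_state Bs M A K st ->
  exists A' K', wf_state Bs M A' K' (foldl (step Bs) st evs) /\
    {subset A <= A'} /\ forall ev, ev \in evs -> ev.1 \in A'.
Proof.
move=> ltM; elim: evs A K st => [|ev evs IH] A K st hv wf.
  by exists A, K; split=> //; split=> // u.
have wf' := wf_step ltM hv wf; have [_ _ _ _ hv'] := hv.
have [A' [K' [wf'' [sA hA]]]] := IH _ _ _ hv' wf'.
exists A', K'; split=> //; split=> [u uA|ev'].
  by apply: sA; rewrite inE uA orbT.
by rewrite inE => /orP [/eqP ->|/hA //]; apply: sA; rewrite mem_head.
Qed.

(** With [t] a single literal of a clause, this shows that the variables of the input formula occur
    in the output, so that its bags may contain them. *)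
Lemma tail_terms Bs st (evs : seq event) (ev : event) t : ev \in evs -> t \in ev.2.2 ->
  exists r, ((r, true) :: t) \in terms (foldl (step Bs) st evs).
Proof.
elim: evs st => // e evs IH st; rewrite inE => /orP [/eqP <-|h] tt; last exact: IH.
exists (fresh st).+1; apply: (@terms_foldl Bs (step Bs st ev)).
by rewrite terms_step mem_cat !inE map_f ?orbT.
Qed.

(** * Moving the token *)

Lemma token_forward Bs M A K st evs f :
  (forall u x, x \in nth [::] Bs u -> x < M) ->
  valid_events Bs A K evs -> wf_state Bs M A K st ->
  (forall t, t \in terms (foldl (step Bs) st evs) -> falsified f t) ->
  (exists2 v, v \in unzip1 (cur st) & f (lookup (0, 0) v (cur st)).1) ->
  (exists2 ev, ev \in evs & ev.2.1 = [::] /\ forall t, t \in ev.2.2 -> falsified f t) \/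
  let st' := foldl (step Bs) st evs in
  exists2 v, v \in unzip1 (cur st') & f (lookup (0, 0) v (cur st')).1.
Proof.
move=> ltM; elim: evs A K st => [|ev evs IH] A K st hv wf hf htok; first by right.
have wf' := wf_step ltM hv wf; have [vK hws _ _ hv'] := hv.
have hft t : t \in new_terms st ev -> falsified f t.
  by move=> h; apply: hf; apply: (@terms_foldl Bs (step Bs st ev));
    rewrite terms_step mem_cat h.
have [[nil hC]|htok'] : (ev.2.1 = [::] /\ forall t, t \in ev.2.2 -> falsified f t) \/
    exists2 v, v \in unzip1 (cur (step Bs st ev)) &
      f (lookup (0, 0) v (cur (step Bs st ev))).1.
- have keys' := keys_step Bs st ev.
  have [v vcur fv] := htok; have [ev1|nev] := eqVneq v ev.1; last first.
    right; exists v; first by rewrite keys' mem_cat inE vcur !orbT.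
    rewrite lookup_step (negbTE nev); case: ifP => // vw.
    case: hws vw => [->|[w wK ->]] //; rewrite inE => /eqP ew.
    by move: vcur; rewrite (wf_keys wf) ew (negbTE wK).
  (* The constraint [q -> q' \/ r]: the token stays at [v], or [r] hands it to a child or to a
     clause. *)
  have : f (fresh st) || f (fresh st).+1.
    have := hft _ (mem_head _ _).
    by rewrite /falsified /= -ev1 fv /= orbF !eqbF_neg !negbK.
  case: (boolP (f (fresh st))) => [fm _|_].
    right; exists v; first by rewrite keys' ev1 mem_cat mem_head orbT.
    rewrite lookup_step ev1 eqxx; case: ifP => // evw.
    case: hws evw => [->|[w wK ->]] //; rewrite inE => /eqP ew.
    by move: vK; rewrite ew (negbTE wK).
  rewrite orFb => fr; case: hws => [nil|[w wK ew]].
    left; split=> // t tt; have : ((fresh st).+1, true) :: t \in new_terms st ev.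
      by rewrite !inE map_f ?orbT.
    by move/hft; rewrite /falsified /= fr.
  right; exists w; first by rewrite keys' ew mem_cat mem_head.
  by rewrite lookup_step ew mem_head.
- by left; exists ev; rewrite ?mem_head.
- case: (IH _ _ _ hv' wf' hf htok') => [[e eevs he]|]; last by right.
  by left; exists e; rewrite // inE eevs orbT.
Qed.

Definition live (st : state) (x : nat) : Prop :=
  (exists2 v, v \in unzip1 (cur st) & x = (lookup (0, 0) v (cur st)).1) \/
  fresh st <= x.

(* Only the values of the live variables matter for the terms still to be
   added, so that a step can choose the value of the variable it consumes. *)
Lemma token_backward Bs M A K st evs f0 :
  (forall u x, x \in nth [::] Bs u -> x < M) ->
  valid_events Bs A K evs -> wf_state Bs M A K st ->
  exists g : nat -> bool,
    (forall f, (forall x, x < M -> f x = f0 x) -> (forall x, live st x -> f x = g x) ->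
       (forall t, t \in terms (foldl (step Bs) st evs) ->
          t \in terms st \/ falsified f t) /\
       let st' := foldl (step Bs) st evs in
       forall v, v \in unzip1 (cur st') -> f (lookup (0, 0) v (cur st')).1 = false) /\
    ((exists2 ev, ev \in evs & ev.2.1 = [::] /\ all (falsified f0) ev.2.2) ->
     exists2 v, v \in unzip1 (cur st) & g (lookup (0, 0) v (cur st)).1).
Proof.
move=> ltM; elim: evs A K st => [|ev evs IH] A K st hv wf.
  exists (fun => false); split=> [f _ fg|[] //]; split=> [t|st' v vK]; first by left.
  by rewrite fg; [|left; exists v].
have wf' := wf_step ltM hv wf; have [vK hws htl _ hv'] := hv.
have [g [hg tok]] := IH _ _ _ hv' wf'.
have keys' := keys_step Bs st ev.
set q := (lookup (0, 0) ev.1 (cur st)).1; set m := fresh st.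
have Mm : M < m := wf_fresh wf.
have vcur : ev.1 \in unzip1 (cur st) by rewrite (wf_keys wf).
have /= [_ _ /andP [Mq qm] _] := wf_cur wf vK; rewrite -/q -/m in Mq qm.
(* A clause is taken whenever [f0] falsifies all its literals, whereas the empty term of a leading
   event is never falsified. For a child, [r] is its current variable, whose value [g] has settled.
   Then [q] must be [q' \/ r], and the dummy false. *)
pose chosen := (ev.2.1 == [::]) && all (falsified f0) ev.2.2.
pose r := if ev.2.1 is [::] then chosen else g m.+1.
exists (fun x => if x == q then g m || r else if x == m.+1 then r
                 else if x == m.+2 then false else g x).
have evK w : w \in ev.2.1 -> w \notin unzip1 (cur st).
  by rewrite (wf_keys wf); case: hws => [->|[w' wK ->]] //; rewrite inE => /eqP ->.
have nvw : ev.1 \notin ev.2.1 by apply/negP => /evK; rewrite vcur.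
have qu u : u \in unzip1 (cur st) -> u != ev.1 ->
    (lookup (0, 0) u (cur st)).1 != q /\ (lookup (0, 0) u (cur st)).1 < m.
  rewrite (wf_keys wf) => uK nu; have /= [_ _ /andP [_ ->] _] := wf_cur wf uK.
  by split=> //; apply: contra nu => /eqP /(wf_inj wf uK vK) ->.
have neq a b : a < b -> ((a == b) = false) * ((b == a) = false).
  by move=> lt; rewrite ltn_eqF ?gtn_eqF.
have m1 : m < m.+1 := ltnSn m; have m2 : m < m.+2 := ltnW (ltnSn m.+1).
have m12 : m.+1 < m.+2 := ltnSn m.+1.
have q1 := ltn_trans qm m1; have q2 := ltn_trans qm m2.
have old x : x < m -> x != q ->
    (if x == q then g m || r else if x == m.+1 then r
     else if x == m.+2 then false else g x) = g x.
  move=> lt /negbTE ->.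
  by rewrite (neq _ _ (ltn_trans lt m1)) (neq _ _ (ltn_trans lt m2)).
split=> [f ff0 fg|].
  have fm : f m = g m.
    by rewrite fg ?(neq _ _ qm) ?(neq _ _ m1) ?(neq _ _ m2) //; right; exact: leqnn.
  have fr : f m.+1 = r.
    by rewrite fg ?(neq _ _ q1) ?eqxx //; right; exact: leqnSn.
  have fd : f m.+2 = false.
    by rewrite fg ?(neq _ _ q2) ?(neq _ _ m12) ?eqxx //; right; exact: ltnW.
  have fq : f q = g m || r by rewrite fg ?eqxx //; left; exists ev.1.
  have fg' x : live (step Bs st ev) x -> f x = g x.
    case=> [[v]|]; last first.
      rewrite -[fresh _]/(m.+3) => hx.
      have h2 := hx : m.+2 < x; have h1 := ltn_trans m12 h2; have h0 := ltn_trans m1 h1.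
      rewrite fg ?(neq _ _ h1) ?(neq _ _ h2) ?(neq _ _ (ltn_trans qm h0)) //.
      by right; exact: ltnW.
    rewrite keys' lookup_step -/m mem_cat inE.
    case: (boolP (v \in ev.2.1)) => [vw _ ->|nw] /=.
      by rewrite fr /r; case: (ev.2.1) vw.
    case: (eqVneq v ev.1) => [_ _ -> //|nv] /= vin ->.
    have [nq lt] := qu v vin nv; rewrite fg; first exact: old.
    by left; exists v.
  have [h1 h2] := hg f ff0 fg'; split=> // t /h1 [|]; last by right.
  rewrite terms_step mem_cat => /orP [/mem_new_terms|]; last by left.
  rewrite -/q -/m => -[->|->|[s sS ->]]; right; rewrite /falsified /=.
  - by rewrite fq fm fr; case: (g m); case: (r).
  - by rewrite fd.
  - rewrite fr; case er: (r) => //=; move: er; rewrite /r.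
    case: hws => [nil|[w _ ew]]; last by rewrite ew in sS.
    rewrite nil => /andP [_ /allP /(_ s sS)]; rewrite /falsified.
    case: (htl s sS) => [->|[l lv ->]] //=.
    by rewrite ff0 //; exact: ltM lv.
have gq : g m || r ->
    exists2 v, v \in unzip1 (cur st) & (if (lookup (0, 0) v (cur st)).1 == q then g m || r
      else if (lookup (0, 0) v (cur st)).1 == m.+1 then r
      else if (lookup (0, 0) v (cur st)).1 == m.+2 then false
      else g (lookup (0, 0) v (cur st)).1).
  by move=> h; exists ev.1 => //; rewrite eqxx.
case=> e; rewrite inE => /orP [/eqP -> [nil hall]|eevs he].
  by apply: gq; rewrite /r /chosen nil /= hall orbT.
have [|v] := tok; first by exists e.
rewrite keys' lookup_step -/m mem_cat inE.
case: (boolP (v \in ev.2.1)) => [vw _ gr|nw] /=.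
  by apply: gq; rewrite /r; case: (ev.2.1) vw => // w ws _; rewrite gr orbT.
case: (eqVneq v ev.1) => [_ _ gm|nv /= vin gv]; first by apply: gq; rewrite gm.
have [nq lt] := qu v vin nv; exists v => //; by rewrite old.
Qed.

(** * The output and its properties *)

Lemma ltn_bits n : n < 2 ^ size (bits n).
Proof. by rewrite /bits size_map size_iota; exact: up_logP. Qed.

Lemma nat_of_bits_ones n : (nat_of_bits (nseq n true)).+1 = 2 ^ n.
Proof. by elim: n => //= n IH; rewrite expnS -IH; lia. Qed.

Lemma vars_base psi x : x \in vars psi -> x < base psi.
Proof.
move=> /mem_vars [C Cpsi [l lC <-]].
rewrite /base map_const -[true :: _]/(nseq (size _).+1 true) -ltnS nat_of_bits_ones.
set n := size _; have : l.1.+1 <= 2 ^ n.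
  apply: leq_trans (ltn_bits _) _; rewrite leq_exp2l // /n size_flatten /shape.
  have : l \in flatten psi by apply/flattenP; exists C.
  elim: (flatten psi) => //= l' s IH; rewrite inE => /orP [/eqP <-|/IH]; lia.
have := expn_gt0 2 n; rewrite expnS /=; lia.
Qed.

Lemma visited_events psi T u : visited (visit_order T) u ->
  {subset node_events psi T.1 u <= events psi T}.
Proof.
rewrite /visited => /orP [/eqP -> ev h|/mapP [e eo ->] ev h]; rewrite /events mem_cat.
  by rewrite h.
apply/orP; right; apply/flattenP.
exists ((e.2, ([:: e.1], [::])) :: node_events psi T.1 e.1); last by rewrite inE h orbT.
by apply/mapP; exists e; rewrite ?mem_rev.
Qed.

Lemma leaf_events psi T ev : ev \in events psi T -> ev.2.1 = [::] ->
  ev.2.2 = [:: [::]] \/ exists2 C, C \in psi & ev.2.2 = [seq [:: l] | l <- C].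
Proof.
have node v : ev \in node_events psi T.1 v ->
    ev.2.2 = [:: [::]] \/ exists2 C, C \in psi & ev.2.2 = [seq [:: l] | l <- C].
  rewrite inE => /orP [/eqP ->|/mapP [C]]; first by left.
  by rewrite mem_filter => /andP [_ Cpsi] ->; right; exists C.
rewrite /events mem_cat => /orP [/node //|/flattenP [s /mapP [e _ ->]]].
by rewrite inE => /orP [/eqP -> //|/node].
Qed.

Definition output (psi : CNF) (T : tree_dec) : DNF * (seq (seq nat) * seq (nat * nat)) :=
  transform (psi, (bags T, links T)).

Lemma output_correct psi (T : tree_dec) :
  well_formed psi -> primal_tree_dec psi T ->
  let psi' := (output psi T).1 in
  let T' := TreeDec (output psi T).2.1 (output psi T).2.2 in
  [/\ well_formed psi', primal_tree_dec psi' T',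
      \max_(B <- bags T') size (undup B) = \max_(B <- bags T) size (undup B) + 4
    & forall a, assignment (vars psi) a ->
        (restrict_cnf psi a = [::] <-> tautology (restrict_dnf psi' a))].
Proof.
move=> wpsi [tree bag_vars vars_bag edge_bag conn] psi' T'.
pose evs := events psi (bags T, links T); pose Bs := bags T.
pose M := base psi; pose st := foldl (step Bs) (start M) evs.
have epsi' : psi' = terms st ++ [seq [:: ((lookup (0, 0) v (cur st)).1, true)]
    | v <- unzip1 (cur st)] by [].
have ebags : bags T' = nbags st by [].
have elinks : links T' = nlinks st by [].
have ltM u x : x \in nth [::] Bs u -> x < M.
  have [lt|ge] := ltnP u (size Bs); last by rewrite nth_default.
  by move=> xu; apply/vars_base/(bag_vars _ _ _ xu); exact: mem_nth.
have hv : valid_events Bs [::] [:: (0, size Bs)] evs by exact: valid_events_tree.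
have wf0 := wf_start Bs M.
have [A [K [wf [_ hA]]]] := wf_run ltM hv wf0; rewrite -/st in wf.
have visA u : u < size Bs -> u \in A.
  move=> lt; apply: (hA (u, ([::], [:: [::]]))).
  apply: (@visited_events _ (bags T, links T) u); last exact: mem_head.
  exact: visited_order.
have clause_event C : C \in psi ->
    exists v, (v, ([::], [seq [:: l] | l <- C])) \in evs.
  (* The variables of a clause are pairwise adjacent in the primal graph, so one bag contains them
     all. *)
  move=> Cpsi; have [|u vu sub] := @search_clique T _ [seq l.1 | l <- C] tree conn
      (search_order tree).
    move=> x y xC yC; have xv z : z \in [seq l.1 | l <- C] -> z \in vars psi.
      by case/mapP => l lC ->; apply/mem_vars; exists C => //; exists l.
    have [B BT h] : exists2 B, B \in bags T & (x \in B) && (y \in B).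
      have [<-|ne] := eqVneq x y.
        by have [B BT xB] := vars_bag x (xv x xC); exists B; rewrite ?xB.
      apply: edge_bag; [exact: xv|exact: xv|].
      by rewrite /primal_edge ne /=; apply/hasP; exists C; rewrite ?xC.
    exists (index B (bags T)); last by rewrite /bag nth_index.
    by apply: visited_order; rewrite ?/nb_nodes ?index_mem.
  exists u; apply: (@visited_events _ (bags T, links T) u) => //.
  rewrite inE; apply/orP; right.
  apply: (map_f (fun C => (u, ([::], [seq [:: l] | l <- C])))).
  rewrite mem_filter Cpsi andbT; apply/allP => l lC.
  by apply: sub; exact: map_f.
have psi'_terms t : t \in psi' ->
    consistent t /\ exists2 B, B \in nbags st & forall l, l \in t -> l.1 \in B.
  rewrite epsi' mem_cat => /orP [/(wf_terms wf) //|/mapP [v vK ->]].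
  split; first exact: uniq_consistent.
  rewrite (wf_keys wf) in vK; have /= [lt qB _ _] := wf_cur wf vK.
  exists (nth [::] (nbags st) (lookup (0, 0) v (cur st)).2); first exact: mem_nth.
  by move=> l; rewrite inE => /eqP ->.
have sub_terms : {subset terms st <= psi'}.
  by move=> t h; rewrite epsi' mem_cat h.
have bag_vars' B x : B \in nbags st -> x \in B -> x \in vars psi'.
  move=> BB xB; have [lt|ge] := ltnP x M; last first.
    by apply: vars_subset sub_terms (wf_vars wf BB xB ge).
  have [/andP [ge _]|[u _ xu]] := wf_bags wf BB xB; first by lia.
  have xpsi : x \in vars psi.
    have [ltu|geu] := ltnP u (size Bs); last by rewrite nth_default in xu.
    by apply: bag_vars xu; exact: mem_nth.
  have /mem_vars [C Cpsi [l lC lx]] := xpsi.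
  have [v ve] := clause_event C Cpsi.
  have [r hr] := tail_terms Bs (start M) ve (map_f (fun l => [:: l]) lC).
  apply/mem_vars; exists [:: (r, true); l]; first exact: sub_terms.
  by exists l; rewrite // !inE eqxx orbT.
split.
- by apply/allP => t /psi'_terms [].
- split.
  + by apply: rooted_is_tree; rewrite ebags elinks; exact: wf_rooted wf.
  + by move=> B x BT; exact: bag_vars'.
  + move=> x /mem_vars [t /psi'_terms [_ [B BB h]] [l lt <-]].
    by exists B => //; exact: h.
  + move=> x y _ _ /andP [_ /hasP [t /psi'_terms [_ [B BB h]] /andP [/mapP [l lt ->]]]].
    by case/mapP => l' l't ->; exists B; rewrite // !h.
  + move=> x i j; apply: rooted_connect; rewrite ebags elinks; exact: wf_rooted wf.
- have [n0 _ _ _] := tree.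
  have [B0 B0B sB0] := wf_copy wf (visA 0 n0).
  rewrite ebags; apply/eqP; rewrite eqn_leq; apply/andP; split.
    (* Size 1 is that of the bag of the first current variable. *)
    apply/bigmax_leqP_seq => B BB _; case: (wf_size wf BB) => [->|[u _ ->]]; first by lia.
    rewrite leq_add2r; have [lt|ge] := ltnP u (size Bs); last by rewrite nth_default.
    by apply: (@leq_bigmax_seq _ _ _ (fun B => size (undup B))) => //; exact: mem_nth.
  have le4 u : u < size Bs -> size (undup (nth [::] Bs u)) + 4 <=
      \max_(B <- nbags st) size (undup B).
    move=> lt; have [B BB <-] := wf_copy wf (visA u lt).
    exact: (@leq_bigmax_seq _ _ _ (fun B => size (undup B))).
  (* The subtraction of 4 is safe, since the copy of the bag of node 0 has at least four
     elements. *)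
  rewrite addnC -leq_subRL; last exact: leq_trans (leq_addl _ _) (le4 0 n0).
  apply/bigmax_leqP_seq => B BB _; have := le4 (index B Bs); rewrite index_mem => /(_ BB).
  rewrite nth_index // addnC => le; rewrite leq_subRL //.
  exact: leq_trans (leq_addr _ _) le.
- move=> a /andP [consa /allP aV].
  have sat := satisfiable_negation_restrict psi' consa.
  split=> [emp /sat [f [fa ft]]|taut].
    have tok0 : exists2 v, v \in unzip1 (cur (start M)) &
        f (lookup (0, 0) v (cur (start M))).1.
      exists 0 => //=; have : [:: (M, false)] \in psi'.
        by apply/sub_terms/terms_foldl; rewrite mem_head.
      by move/ft; rewrite /falsified /= orbF; case: (f M).
    have hf t : t \in terms st -> falsified f t by move/sub_terms/ft.
    case: (token_forward ltM hv wf0 hf tok0) => [[ev evE [nil hC]]|[v vK fv]].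
      case: (leaf_events evE nil) => [e|[C Cpsi e]].
        (* A leading event cannot take the token, because no valuation falsifies the empty term. *)
        by have := hC [::]; rewrite e mem_head => /(_ isT).
      have : has (fun l => l \in a) C.
        case: (boolP (has _ C)) => // nh.
        have : [seq l <- C | neg_lit l \notin a] \in restrict_cnf psi a.
          by apply: map_f; rewrite mem_filter nh.
        by rewrite emp.
      case/hasP => l lC la; have := hC [:: l]; rewrite e map_f // => /(_ isT).
      by rewrite /falsified /= (fa l la) eqxx.
    have : [:: ((lookup (0, 0) v (cur st)).1, true)] \in psi'.
      rewrite epsi' mem_cat; apply/orP; right.
      exact: (map_f (fun v => [:: ((lookup (0, 0) v (cur st)).1, true)])).
    by move/ft; rewrite /falsified /= fv.
  apply/eqP; rewrite -size_eq0 size_map size_filter -leqn0 leqNgt -has_count.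
  apply/negP => /hasP [C Cpsi /= /hasPn Ca]; apply: taut; apply/sat.
  have /allP consC : consistent C by move/allP: wpsi; exact.
  (* Where [a] is silent, a variable of [C] gets the value that falsifies its literal; as [C] is
     consistent, there is only one polarity to respect. *)
  pose f0 x := if (x, true) \in a then true else if (x, false) \in a then false
               else (x, false) \in C.
  have f0C l : l \in C -> f0 l.1 != l.2.
    move=> lC; have := Ca l lC; have := consC l lC; rewrite /f0 /neg_lit.
    case: l lC => x [] /= lC nlC /negbTE la; rewrite la.
      by rewrite (negbTE nlC); case: ifP.
    by rewrite lC; case: ifP.
  have f0a l : l \in a -> f0 l.1 = l.2.
    move/allP: consa => /(_ l); rewrite /f0 /neg_lit.
    by case: l => x [] /= h la; rewrite la // (negbTE (h la)).
  have [g [hg tok]] := token_backward f0 ltM hv wf0.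
  have [v ve] := clause_event C Cpsi.
  (* At the start only node 0 has a current variable, so the true one given by [tok] is [M]. *)
  have gM : g M.
    have [|u] := tok.
      exists (v, ([::], [seq [:: l] | l <- C])) => //; split=> //=.
      by apply/allP => t /mapP [l lC ->]; rewrite /falsified /= f0C.
    by rewrite inE => /eqP ->.
  pose f x := if x < M then f0 x else g x.
  have [|x|h1 h2] := hg f; first by move=> x lt; rewrite /f lt.
    case=> [[u]|]; first by rewrite inE => /eqP -> /= ->; rewrite /f ltnn.
    by rewrite /fresh /= => lt; rewrite /f ltnNge ltnW.
  exists f; split=> [l la|t].
    by rewrite /f vars_base ?aV // f0a.
  rewrite epsi' mem_cat => /orP [/h1 [|//]|/mapP [u uK ->]].
    by rewrite inE => /eqP ->; rewrite /falsified /f /= ltnn gM.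
  by rewrite /falsified /= h2.
Qed.

Theorem lemma13 :
  exists (P : cmd) (p : {poly nat}),
    forall (psi : CNF) (T : tree_dec) (k : int),
      well_formed psi -> primal_tree_dec psi T -> width T = k ->
      exists (psi' : DNF) (T' : tree_dec) (t : nat),
        [/\ runs P (enc_instance psi T) (enc_instance psi' T') t,
            t <= (p.[data_size (enc_instance psi T)])%R,
            well_formed psi',
            primal_tree_dec psi' T' /\ width T' = (k + 4)%R
          & forall a : seq literal, assignment (vars psi) a ->
              (restrict_cnf psi a = [::] <-> tautology (restrict_dnf psi' a))].
Proof.
have [c [n [q [[d qd] hc]]]] := polytime_transform.
(* The bound [x.+2 ^ d] of [pbounded], written as a polynomial. *)
exists c, (('X + 2%:P) ^+ d)%R => psi T k wpsi tdec wT.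
have [wf' tdec' wid eqv] := output_correct wpsi tdec.
exists (output psi T).1, (TreeDec (output psi T).2.1 (output psi T).2.2).
pose i := (psi, (bags T, links T)).
have [s [t [ex [es _] le]]] := hc (update (fun => Leaf) 0 (enc i)) i (update_eq _ _ _).
exists t; split=> //.
- by exists s => //; rewrite es /output -/i; case: (transform i) => F [Bs L].
- apply: leq_trans le _; apply: leq_trans (qd _) _.
  by rewrite horner_exp hornerD hornerX hornerC natrXE natrDE addn2.
- split=> //; move: wT; rewrite /width wid => <-.
  by rewrite PoszD; lia.
Qed.
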